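(* Let $X$ be a separable real Banach space. Then $X$ is reflexive if and only if there exists an equivalent norm $|||\cdot|||$ on $X$ satisfying, for any bounded sequence $(x_n)\subseteq X$: (a) if $\lim_{m\to\infty}\lim_{n\to\infty}|||x_m+x_n|||=2\lim_{n\to\infty}|||x_n|||$, then $(x_n)$ is norm convergent. Furthermore, the norm $|||\cdot|||$ in (a) satisfies: (b) if $(x_n)$ is weakly null but not norm null, then $$\lim_{m\to\infty}\lim_{n\to\infty}|||x_m+x_n|||>\lim_{m\to\infty}|||x_m|||,$$ provided both limits exist.
   Context: An equivalent norm on $X$ is a norm inducing the same topology as the original norm of $X$. The hypothesis in (a), an equality of limits, is understood to include the existence of the limits involved. *)

(* Defs.v *)
From HB Require Import structures.
From mathcomp Require Import all_boot all_order all_algebra.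
From mathcomp Require Import all_classical all_reals all_analysis.

Set Implicit Arguments.
Unset Strict Implicit.
Unset Printing Implicit Defensive.

Import Order.TTheory GRing.Theory Num.Theory.
Import numFieldNormedType.Exports.

Local Open Scope classical_set_scope.
Local Open Scope ring_scope.

Section dual_space.
Context {R : realType} {X : normedModType R}.

Definition is_dual : {pred X -> R^o} :=
  [pred f | `[< linear f /\ continuous f >]].

Lemma is_dual_submod_closed : submod_closed is_dual.
Proof.
split; first by apply/asboolP; split => [a x y|x];
  [rewrite /= scaler0 addr0|exact: cvg_cst].
move=> a f g /asboolP[fl fc] /asboolP[gl gc]; apply/asboolP; split.
  by move=> b x y /=; rewrite !fctE/= fl gl !scalerDr !scalerA mulrC addrACA.
by move=> x; apply: cvgD; [apply: cvgZr; exact: fc|exact: gc].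
Qed.

HB.instance Definition _ :=
  GRing.isSubmodClosed.Build R (X -> R^o) is_dual is_dual_submod_closed.

End dual_space.

Record dual (R : realType) (X : normedModType R) := Dual {
  dual_fun :> X -> R^o ;
  dual_funP : dual_fun \in is_dual }.

Section dual_normed.
Context {R : realType} {X : normedModType R}.

HB.instance Definition _ := [isSub for @dual_fun R X].
HB.instance Definition _ := [Choice of dual X by <:].
HB.instance Definition _ := [SubChoice_isSubLmodule of dual X by <:].

Implicit Types f g : dual X.

Definition dual_ball_image f : set R :=
  [set `|f x| | x in [set x : X | `|x| <= 1]].

Definition dual_norm f : R := sup (dual_ball_image f).

Lemma dual_linear f : linear f.
Proof. by have /asboolP[] := dual_funP f. Qed.

Lemma dual_continuous f : continuous f.
Proof. by have /asboolP[] := dual_funP f. Qed.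

Lemma dualZ f (a : R) x : f (a *: x) = a * f x.
Proof.
have f0 : f 0 = 0.
  have := dual_linear f 1 0 0; rewrite !scale1r addr0 => /eqP.
  by rewrite -subr_eq0 opprD addrA subrr sub0r oppr_eq0 => /eqP.
by have := dual_linear f a x 0; rewrite f0 !addr0.
Qed.

Lemma dual_ball_image_has_sup f : has_sup (dual_ball_image f).
Proof.
split; first by exists `|f 0|, 0 => //=; rewrite normr0.
pose L := GRing.isLinear.Build R X R^o *:%R f (dual_linear f).
pose F : {linear X -> R^o} := HB.pack (f : X -> R^o) L.
have /linear_boundedP : bounded_near F (nbhs 0).
  exact/linear_bounded_continuous/dual_continuous.
move=> /pinfty_ex_gt0[M M0 fM]; exists M => _ /= [x x1 <-].
by rewrite (le_trans (fM x))// -[leRHS]mulr1 ler_wpM2l// ltW.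
Qed.

Lemma dual_norm_ub f x : `|x| <= 1 -> `|f x| <= dual_norm f.
Proof.
move=> x1; apply: ub_le_sup; last by exists x.
by have [] := dual_ball_image_has_sup f.
Qed.

Lemma dual_norm_ge0 f : 0 <= dual_norm f.
Proof. by rewrite (le_trans (normr_ge0 (f 0)))// dual_norm_ub ?normr0. Qed.

Lemma dual_norm_le f (M : R) :
  (forall x, `|x| <= 1 -> `|f x| <= M) -> dual_norm f <= M.
Proof.
move=> fM; apply: ge_sup; first by have [] := dual_ball_image_has_sup f.
by move=> _ [x x1 <-]; exact: fM.
Qed.

Lemma dual_normD f g : dual_norm (f + g) <= dual_norm f + dual_norm g.
Proof.
apply: dual_norm_le => x x1.
by rewrite (le_trans (ler_normD (f x) (g x)))// lerD// dual_norm_ub.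
Qed.

Lemma dual_normZ (a : R) f : dual_norm (a *: f) = `|a| * dual_norm f.
Proof.
have le b h : dual_norm (b *: h) <= `|b| * dual_norm h.
  apply: dual_norm_le => x x1; rewrite (normrM b (h x)).
  by rewrite ler_wpM2l// dual_norm_ub.
apply/eqP; rewrite eq_le le/=; have [->|a0] := eqVneq a 0.
  by rewrite normr0 mul0r dual_norm_ge0.
rewrite -ler_pdivlMl ?normr_gt0// -normfV -[X in dual_norm X <= _]scale1r.
by rewrite -(mulVf a0) -scalerA le.
Qed.

Lemma dual_norm0_eq0 f : dual_norm f = 0 -> f = 0.
Proof.
move=> f0; apply/val_inj/funext => x /=; have [->|x0] := eqVneq x 0.
  by have := dualZ f 0 0; rewrite scale0r mul0r.
have : `|f (`|x|^-1 *: x)| <= 0.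
  rewrite -f0 dual_norm_ub// normrZ normfV normr_id mulVf//.
  by rewrite normr_eq0.
rewrite dualZ normr_le0 mulf_eq0 invr_eq0 normr_eq0 (negPf x0)/=.
by move=> /eqP.
Qed.

HB.instance Definition _ :=
  Lmodule_isNormed.Build R (dual X) dual_normD dual_normZ dual_norm0_eq0.

End dual_normed.

(* surjectivity of the canonical embedding of X into its bidual *)
Definition reflexive_space (R : realType) (X : normedModType R) :=
  forall F : dual (dual X), exists x : X, forall f : dual X, F f = f x.

Definition separable_space (T : topologicalType) :=
  exists2 S : set T, countable S & dense S.

Definition weakly_null (R : realType) (X : normedModType R) (x : nat -> X) :=
  forall f : dual X, f (x n) @[n --> \oo] --> (0 : R).

Record is_norm (R : realType) (X : lmodType R) (N : X -> R) : Prop := IsNorm {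
  is_norm_triangle : forall x y, N (x + y) <= N x + N y ;
  is_norm_scale : forall (a : R) x, N (a *: x) = `|a| * N x ;
  is_norm_eq0 : forall x, N x = 0 -> x = 0 }.

Definition norm_open (R : realType) (X : lmodType R) (N : X -> R)
    (A : set X) :=
  forall x, A x -> exists2 e : R, 0 < e & forall y, N (y - x) < e -> A y.

Definition equivalent_norm (R : realType) (X : normedModType R)
    (N : X -> R) :=
  is_norm N /\ (forall A : set X, open A <-> norm_open N A).

(* lim_m lim_n u m n exists (every inner limit included) and equals l *)
Definition iterated_lim_to (R : realType) (u : nat -> nat -> R) (l : R) :=
  (forall m, cvgn (u m)) /\ limn (u m) @[m --> \oo] --> l.

Definition double_limit_convergence (R : realType) (X : normedModType R)
    (N : X -> R) :=
  forall (x : nat -> X) (l : R), bounded_set (range x) ->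
    N (x n) @[n --> \oo] --> l ->
    iterated_lim_to (fun m n => N (x m + x n)) (2 * l) ->
    cvgn x.

Definition weakly_null_double_limit_gt (R : realType) (X : normedModType R)
    (N : X -> R) :=
  forall (x : nat -> X) (l l2 : R), weakly_null x ->
    ~ (x @ \oo --> (0 : X)) ->
    N (x n) @[n --> \oo] --> l ->
    iterated_lim_to (fun m n => N (x m + x n)) l2 ->
    l < l2.

(* Main.v *)
(** For a dense sequence c, put N x = sum_j p_j (| |x| c_j + x | + | |x| c_j - x |). If
    N x_m + N x_n - N (x_m + x_n) has iterated limit 0 along an ultrafilter, then, by density of c,
    so does |b + x_m| + |b + x_n| - |2b + x_m + x_n| for every b. Subtracting the weak limit
    (reflexivity) gives a weakly null u with the same property, and if |u_n| did not tend to 0, a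
    sequence v of terms of u would satisfy |sum_i 2^-i v_i| ~ lim |u_n| so tightly that the norming
    functional of the sum does not tend to 0 on v. Hence (x_n) converges along the ultrafilter, and
    the strict convexity of N makes the limit independent of it, which is (a). If (b) fails, the
    partial sums of suitably chosen terms are bounded and satisfy the same near-additivity, hence
    converge along an ultrafilter, although consecutive terms stay apart.

    Conversely, let N satisfy (a) and phi f = sup_x (f x - N(x)^2/2) on the dual. For F in the bidual
    and eps > 0, Ekeland's principle for phi - F yields an f such that every direction h admits a
    maximizing sequence (x_k) for f with lim h x_k >= F h - eps |h|. Maximizing sequences are
    near-additive for N, so by (a) they subconverge to one and the same maximizer y; thus
    |F - y| <= eps. As X is complete, F belongs to X. *)

From HB Require Import structures.
Require Import Defs.
From mathcomp Require Import all_boot all_order all_algebra.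
From mathcomp Require Import all_classical all_reals all_analysis.
From mathcomp Require Import ring lra.
Import numFieldNormedType.Exports.

Set Implicit Arguments.
Unset Strict Implicit.
Unset Printing Implicit Defensive.

Import Order.TTheory GRing.Theory Num.Theory.

Local Open Scope classical_set_scope.
Local Open Scope ring_scope.

(** * Hahn-Banach for sublinear functionals, by minimality *)

Section hahn_banach.
Context {R : realType} {V : lmodType R}.
Implicit Types (p q : V -> R) (x y : V).

Definition sublinear q :=
  (forall x y, q (x + y) <= q x + q y) /\
  (forall (a : R) x, 0 <= a -> q (a *: x) = a * q x).

Lemma sublinear0 q : sublinear q -> q 0 = 0.
Proof. by case=> _ qZ; have := qZ 0 0 (lexx _); rewrite scale0r mul0r. Qed.

Lemma sublinear_geN q x : sublinear q -> - q (- x) <= q x.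
Proof.
move=> sq; rewrite lerNl -subr_ge0 opprK addrC.
by have := sq.1 x (- x); rewrite subrr sublinear0.
Qed.

Definition tilt_set q y x : set R := [set q (x + t *: y) - t * q y | t in [set t | 0 <= t]].

(** For sublinear [q], this is the largest sublinear functional below [q] whose value at [- y] is at
    most [- q y]; it is therefore linear on the line through [y]. *)
Definition tilt q y x : R := inf (tilt_set q y x).

Lemma tilt_set_lb q y x : sublinear q -> lbound (tilt_set q y x) (- q (- x)).
Proof.
move=> [qD qZ] _ [t /= t0 <-].
by rewrite -qZ// lerBrDl lerBlDr; have := qD (x + t *: y) (- x); rewrite addrAC subrr add0r.
Qed.

Lemma tilt_has_inf q y x : sublinear q -> has_inf (tilt_set q y x).
Proof.
move=> sq; split; last by exists (- q (- x)); exact: tilt_set_lb.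
by exists (q (x + 0 *: y) - 0 * q y), 0 => /=.
Qed.

Lemma tilt_le q y x (t : R) : sublinear q -> 0 <= t -> tilt q y x <= q (x + t *: y) - t * q y.
Proof.
move=> sq t0; apply: ge_inf; first by have [] := tilt_has_inf y x sq.
by exists t.
Qed.

Lemma le_tilt q y x (m : R) : (forall t : R, 0 <= t -> m <= q (x + t *: y) - t * q y) ->
  m <= tilt q y x.
Proof.
move=> h; apply: lb_le_inf; first by exists (q (x + 0 *: y) - 0 * q y), 0 => /=.
by move=> _ [t /= t0 <-]; exact: h.
Qed.

Lemma tilt_le_self q y x : sublinear q -> tilt q y x <= q x.
Proof. by move=> sq; have := tilt_le y x sq (lexx 0); rewrite scale0r addr0 mul0r subr0. Qed.

(** Parameters [t] and [s] for the two summands merge into [t + s]. For homogeneity one inequality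
    suffices, applied to both [a] and [a^-1]. *)
Lemma tilt_sublinear q y : sublinear q -> sublinear (tilt q y).
Proof.
move=> sq; have [qD qZ] := sq.
have tZ (a : R) x : 0 < a -> tilt q y (a *: x) <= a * tilt q y x.
  move=> a0; rewrite -ler_pdivrMl//; apply: le_tilt => t t0.
  rewrite ler_pdivrMl// mulrBr -(qZ a _ (ltW a0)) scalerDr scalerA mulrA.
  by apply: tilt_le => //; rewrite mulr_ge0// ltW.
split=> [x1 x2|a x].
  rewrite -lerBlDr; apply: le_tilt => t t0; rewrite lerBlDr -lerBlDl.
  apply: le_tilt => s s0; rewrite lerBlDl.
  apply: (le_trans (tilt_le y (x1 + x2) sq (addr_ge0 t0 s0))).
  rewrite scalerDl addrACA mulrDl opprD [leRHS]addrACA lerD2r.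
  exact: qD.
rewrite le_eqVlt => /predU1P[<-|a0].
  rewrite scale0r mul0r; apply/eqP; rewrite eq_le -{1}(sublinear0 sq) tilt_le_self//=.
  by apply: le_tilt => t t0; rewrite add0r qZ// subrr.
apply/eqP; rewrite eq_le tZ//= -ler_pdivlMl//.
have := tZ a^-1 (a *: x); rewrite invr_gt0 => /(_ a0).
by rewrite scalerA mulVf ?gt_eqF// scale1r.
Qed.

(** Zorn's lemma for the reversed pointwise order. A chain has its pointwise infimum as bound,
    finite because every member stays above [- p (- x)]. Of two members of the chain the smaller one
    serves both arguments, which makes the infimum subadditive. *)
Lemma minimal_sublinear p : sublinear p -> exists q, [/\ sublinear q, forall x, q x <= p x &
  forall r, sublinear r -> (forall x, r x <= q x) -> r = q].
Proof.
move=> sp; pose P q := `[< sublinear q /\ forall x, q x <= p x >].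
pose le (q r : {q | P q}) := `[< forall x, sval r x <= sval q x >].
have Pp : P p by apply/asboolP.
have [||||[q Pq] qmin] := @Zorn {q | P q} le.
- by move=> t; apply/asboolP.
- move=> r s t /asboolP rs /asboolP st; apply/asboolP => x.
  exact: le_trans (st x) (rs x).
- move=> [s Ps] [t Pt] /asboolP/= st /asboolP/= ts; apply/eq_exist/funext => x.
  by apply/eqP; rewrite eq_le st ts.
- move=> A totA; have [->|/set0P[q0 Aq0]] := eqVneq A set0.
    by exists (exist _ p Pp).
  pose V_ x : set R := [set sval q x | q in A].
  have lbV x : lbound (V_ x) (- p (- x)).
    move=> _ [[q Pq] _ <-] /=; have /asboolP[sq qp] := Pq.
    by rewrite (le_trans _ (sublinear_geN x sq))// lerN2.
  have infV x : has_inf (V_ x).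
    by split; [exists (sval q0 x), q0|exists (- p (- x)); exact: lbV].
  pose m x := inf (V_ x).
  have m_le x (q : {q | P q}) : A q -> m x <= sval q x.
    by move=> Aq; apply: ge_inf; [have [] := infV x|exists q].
  have le_m x (a : R) : (forall q : {q | P q}, A q -> a <= sval q x) -> a <= m x.
    by move=> h; apply: lb_le_inf => [|_ [q Aq <-]]; [have [] := infV x|exact: h].
  suff Pm : P m by exists (exist _ m Pm) => q Aq; apply/asboolP => x /=; exact: m_le.
  apply/asboolP; split; last first.
    move=> x; rewrite (le_trans (m_le x _ Aq0))//.
    by case: (q0) => q Pq /=; have /asboolP[_] := Pq.
  split=> [x y|a x a0].
    rewrite -lerBlDr; apply: (le_m) => q Aq; rewrite lerBlDr -lerBlDl.
    apply: (le_m) => r Ar; rewrite lerBlDl.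
    have [/asboolP qr|/asboolP rq] := totA _ _ Aq Ar.
      case: r Ar qr => r Pr /= Ar qr; have /asboolP[[rD _] _] := Pr.
      by rewrite (le_trans (m_le _ _ Ar))//= (le_trans (rD _ _))// lerD2r.
    case: q Aq rq => q Pq /= Aq rq; have /asboolP[[qD _] _] := Pq.
    by rewrite (le_trans (m_le _ _ Aq))//= (le_trans (qD _ _))// lerD2l.
  move: a0; rewrite le_eqVlt => /predU1P[<-|a0].
    rewrite scale0r mul0r; apply/eqP; rewrite eq_le; apply/andP; split.
      rewrite (le_trans (m_le _ _ Aq0))//.
      by case: (q0) => q Pq /=; have /asboolP[sq _] := Pq; rewrite sublinear0.
    by apply: (le_m) => -[q Pq] _ /=; have /asboolP[sq _] := Pq; rewrite sublinear0.
  apply/eqP; rewrite eq_le; apply/andP; split.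
    rewrite -ler_pdivrMl//; apply: (le_m) => q Aq; rewrite ler_pdivrMl//.
    rewrite (le_trans (m_le _ _ Aq))//; case: q {Aq} => q Pq /=.
    by have /asboolP[[_ ->]] := Pq; rewrite // ltW.
  apply: (le_m) => q Aq; have := m_le x _ Aq; rewrite -(ler_pM2l a0) => /le_trans; apply.
  by case: q {Aq} => q Pq /=; have /asboolP[[_ ->]] := Pq; rewrite // ltW.
have /asboolP[sq qp] := Pq; exists q; split => // r sr rq.
have Pr : P r by apply/asboolP; split => // x; exact: le_trans (rq x) (qp x).
by have /(congr1 sval) := qmin (exist _ r Pr) (introT (asboolP _) rq).
Qed.

(* A pointwise minimal sublinear functional [q <= tilt p x0] is linear, since [tilt q y = q] for
   every [y]; tilting [p] first gives [q (- x0) <= - p x0], that is, equality at [x0]. *)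
Lemma hahn_banach p x0 : sublinear p ->
  exists f : V -> R, [/\ forall (a : R) x y, f (a *: x + y) = a * f x + f y,
    forall x, f x <= p x & f x0 = p x0].
Proof.
move=> sp; have [q [sq qp qmin]] := minimal_sublinear (tilt_sublinear x0 sp).
have [qD qZ] := sq.
have tq y : tilt q y = q.
  by apply: qmin => [|x]; [exact: tilt_sublinear|exact: tilt_le_self].
have D x y : q (x + y) = q x + q y.
  apply/eqP; rewrite eq_le qD/= -lerBrDr.
  by have := tilt_le y x sq ler01; rewrite tq scale1r mul1r.
have N x : q (- x) = - q x.
  by apply/eqP; rewrite -subr_eq0 opprK -D addrC subrr sublinear0.
have qp' x : q x <= p x by rewrite (le_trans (qp x))// tilt_le_self.
exists q; split=> //.
  move=> a x y; rewrite D; congr (_ + _); have [a0|a0] := leP 0 a; first exact: qZ.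
  by rewrite -[a]opprK scaleNr N qZ ?oppr_ge0 ?ltW// -mulNr.
apply/eqP; rewrite eq_le qp'/= -[leRHS]opprK -N lerNr.
rewrite (le_trans (qp _))//; have := tilt_le x0 (- x0) sp ler01.
by rewrite scale1r addNr mul1r sublinear0// sub0r.
Qed.

End hahn_banach.

(** * Limits along ultrafilters *)

Section ultrafilters.

Lemma ultra_compact_cvg (I : Type) (U : set_system I) (T : topologicalType)
    (f : I -> T) (A : set T) : UltraFilter U -> compact A ->
  (\forall i \near U, A (f i)) -> exists2 p, A p & f i @[i --> U] --> p.
Proof.
move=> uU cA UA; have [p [Ap cp]] := cA _ (fmap_proper_filter f (@ultra_proper _ _ uU)) UA.
exists p => // B pB; have [//|UB] := in_ultra_setVsetC (f @^-1` B) uU.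
by have [y [/=]] := cp (~` B) B UB pB.
Qed.

Lemma ultra_bounded_cvg (I : Type) (U : set_system I) (R : realType)
    (u : I -> R) (M : R) : UltraFilter U ->
  (\forall i \near U, `|u i| <= M) -> exists2 l, `|l| <= M & u i @[i --> U] --> l.
Proof.
move=> uU uM; have [|l lM ul] := @ultra_compact_cvg _ U R u `[- M, M] uU (@segment_compact _ _ _).
  by apply: filterS uM => i /=; rewrite in_itv/= ler_norml.
by exists l => //; rewrite ler_norml; move: lM; rewrite /= in_itv.
Qed.

(** If the preimage of a neighbourhood [B] were missing from [F], the trace of [F] on its complement
    would extend to an ultrafilter along which [f] avoids [B]. This reduces limits of sequences to
    ultrafilters, along which bounded reals always converge. *)
Lemma cvg_of_ultra (I : Type) (F : set_system I) (T : topologicalType)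
    (f : I -> T) (l : T) : ProperFilter F ->
  (forall U : set_system I, UltraFilter U -> F `<=` U -> f i @[i --> U] --> l) ->
    f i @[i --> F] --> l.
Proof.
move=> pF fU B lB; apply: contrapT => nFB.
pose D := ~` (f @^-1` B).
have pD : ProperFilter (within D F).
  apply: Build_ProperFilter_ex => A; rewrite /within/= => FA; apply: contrapT => nA.
  apply: nFB; apply: filterS FA => i DA; apply: contrapT => nB.
  by apply: nA; exists i; exact: DA.
have [U [uU DU]] := ultraFilterLemma pD.
have FU : F `<=` U by apply: subset_trans DU; exact: cvg_within.
have UB : U (f @^-1` B) := fU U uU FU B lB.
have UD : U D by apply: DU; rewrite /within/=; exact: filterE.
by have [i [? ]] := filter_ex (filterI UB UD).
Qed.

End ultrafilters.

(** * Elementary facts on the dual space *)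

Section dual_facts.
Context {R : realType} {X : normedModType R}.
Implicit Types (f g : dual X) (x y : X).

Lemma dualD f x y : f (x + y) = f x + f y.
Proof. by have := dual_linear f 1 x y; rewrite !scale1r. Qed.

Lemma dualN f x : f (- x) = - f x.
Proof. by rewrite -scaleN1r dualZ mulN1r. Qed.

Lemma dualB f x y : f (x - y) = f x - f y.
Proof. by rewrite dualD dualN. Qed.

Lemma dual0 f : f 0 = 0.
Proof. by rewrite -(scale0r 0) dualZ mul0r. Qed.

Lemma dual_oppE f x : (- f) x = - f x.
Proof. by []. Qed.

Lemma dual_le_norm f x : `|f x| <= `|f| * `|x|.
Proof.
have [->|x0] := eqVneq x 0; first by rewrite dual0 !normr0 mulr0.
rewrite -ler_pdivrMr ?normr_gt0//.
have -> : `|f x| / `|x| = `|f (`|x|^-1 *: x)| by rewrite dualZ normrM normfV normr_id mulrC.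
by apply: dual_norm_ub; rewrite normrZ normfV normr_id mulVf// normr_eq0.
Qed.

Lemma dual_norm_le_bound f (M : R) : 0 <= M -> (forall x, `|f x| <= M * `|x|) -> `|f| <= M.
Proof.
move=> M0 fM; apply: dual_norm_le => x x1.
by rewrite (le_trans (fM x))// ler_piMr.
Qed.

Lemma dual_of_bounded (f : X -> R) (C : R) :
  (forall (a : R) x y, f (a *: x + y) = a * f x + f y) -> (forall x, `|f x| <= C * `|x|) ->
  exists g : dual X, forall x, g x = f x.
Proof.
move=> fl fC.
suff fd : (f : X -> R^o) \in is_dual by exists (Dual fd).
apply/asboolP; split => //.
pose L := GRing.isLinear.Build R X R^o *:%R f fl.
pose F : {linear X -> R^o} := HB.pack (f : X -> R^o) L.
suff: continuous F by []; apply/linear_bounded_continuous; apply/linear_boundedP;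
  near=> M => x; rewrite (le_trans (fC x))//.
by rewrite ler_wpM2r//; near: M; exact: nbhs_pinfty_ge.
Unshelve. all: by end_near. Qed.

End dual_facts.

(** * Supporting functionals and weak limits *)

Section weak_topology.
Context {R : realType} {X : normedModType R}.
Implicit Types (f g : dual X) (x y : X).

Definition seminorm (p : X -> R) :=
  (forall x y, p (x + y) <= p x + p y) /\ (forall (a : R) x, p (a *: x) = `|a| * p x).

Lemma seminorm_normr : seminorm (fun x => `|x|).
Proof. by split; [exact: ler_normD|exact: normrZ]. Qed.

Lemma seminorm_ge0 (p : X -> R) x : seminorm p -> 0 <= p x.
Proof.
move=> [pD pZ]; have p0 : p 0 = 0 by rewrite -(scale0r 0) pZ normr0 mul0r.
have := pD x (- x); rewrite subrr p0 -scaleN1r pZ normrN normr1 mul1r.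
by rewrite -mulr2n pmulrn_lge0.
Qed.

Lemma seminorm_sublinear (p : X -> R) : seminorm p -> sublinear p.
Proof. by move=> [pD pZ]; split=> // a x a0; rewrite pZ ger0_norm. Qed.

Lemma seminormN (p : X -> R) x : seminorm p -> p (- x) = p x.
Proof. by move=> [_ pZ]; rewrite -scaleN1r pZ normrN normr1 mul1r. Qed.

Lemma seminorm_support (p : X -> R) (C : R) x0 : seminorm p ->
  (forall x, p x <= C * `|x|) ->
  exists2 f : dual X, forall x, `|f x| <= p x & f x0 = p x0.
Proof.
move=> sp pC; have [f [fl fp fx0]] := hahn_banach x0 (seminorm_sublinear sp).
have f0 : f 0 = 0.
  by apply/eqP; have := fl 1 0 0; rewrite scaler0 addr0 mul1r -subr_eq0 => /eqP; lra.
have fp' x : `|f x| <= p x.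
  rewrite ler_norml fp andbT lerNl -(seminormN x sp) (le_trans _ (fp _))//.
  by have := fl (-1) x 0; rewrite !addr0 scaleN1r mulN1r f0 addr0 => ->.
have [g gf] := dual_of_bounded fl (fun x => le_trans (fp' x) (pC x)).
by exists g => [x|]; rewrite gf.
Qed.

Lemma norming_functional x0 : exists2 f : dual X, forall x, `|f x| <= `|x| & f x0 = `|x0|.
Proof.
apply: (@seminorm_support (fun x => `|x|) 1) => [|x]; first exact: seminorm_normr.
by rewrite mul1r.
Qed.

(** A functional below [p] that supports [p] at [c] gives [p (c + u i) >= p c + f (u i)], and
    [f (u i)] tends to 0. *)
Lemma seminorm_weakly_lsc (I : Type) (F : set_system I) (p : X -> R) (C : R)
    (u : I -> X) c (e : R) :
  Filter F -> seminorm p -> (forall x, p x <= C * `|x|) ->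
  (forall f, f (u i) @[i --> F] --> (0 : R)) -> 0 < e ->
  \forall i \near F, p c - e < p (c + u i).
Proof.
move=> fF sp pC fu e0; have [f fp fc] := seminorm_support c sp pC.
have /cvgrPdist_lt/(_ e e0) := fu f.
apply: filterS => i; rewrite sub0r normrN => fe.
have := fp (c + u i); rewrite dualD fc => /(le_trans (ler_norm _)).
by move: fe; rewrite ltr_norml => /andP[]; lra.
Qed.

(** The limits of [f (x i)] depend linearly and boundedly on [f], so they form an element of the
    bidual, which reflexivity represents by a vector. *)
Lemma weak_ultralimit (I : Type) (U : set_system I) (x : I -> X) (M : R) :
  reflexive_space X -> UltraFilter U -> (\forall i \near U, `|x i| <= M) ->
  exists w, forall f, f (x i) @[i --> U] --> (f w : R).
Proof.
move=> refX uU xM.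
have fx f : exists2 l, `|l| <= `|f| * M & f (x i) @[i --> U] --> (l : R).
  apply: ultra_bounded_cvg; apply: filterS xM => i xi.
  by rewrite (le_trans (dual_le_norm f _))// ler_wpM2l.
pose L f : R := lim (f (x i) @[i --> U]).
have Lcvg f : f (x i) @[i --> U] --> L f.
  by have [l _ fl] := fx f; apply: cvgP fl.
have Ll (a : R) f g : L (a *: f + g) = a * L f + L g.
  apply: cvg_lim => //; apply: cvgD; last exact: Lcvg.
  by apply: cvgMl_tmp; exact: Lcvg.
have Lb f : `|L f| <= M * `|f|.
  by have [l lM /cvg_lim] := fx f; rewrite /L => ->//; rewrite mulrC.
have [g gL] := dual_of_bounded Ll Lb.
have [w gw] := refX g; exists w => f.
by rewrite -gw gL; exact: Lcvg.
Qed.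

End weak_topology.

(** * Cauchy sequences with an explicit rate *)

Section cauchy_rate.
Context {R : realType}.

Lemma cvg_rate (T : normedModType R) (x : nat -> T) (e : nat -> R) (l : T) :
  (forall k n, (k <= n)%N -> `|x k - x n| <= e k) -> x n @[n --> \oo] --> l ->
  forall k, `|x k - l| <= e k.
Proof.
move=> xe xl k; apply: (@ler_cvg_to _ \oo _ _ (fun n => `|x k - x n|) (fun=> e k)).
- by apply: cvg_norm; apply: cvgB; [exact: cvg_cst|exact: xl].
- exact: cvg_cst.
- by near=> n; apply: xe; near: n; exact: nbhs_infty_ge.
Unshelve. all: by end_near. Qed.

Lemma cauchy_rate_cvg (T : completeNormedModType R) (x : nat -> T) (e : nat -> R) :
  (forall k n, (k <= n)%N -> `|x k - x n| <= e k) -> e n @[n --> \oo] --> (0 : R) ->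
  cvgn x.
Proof.
move=> xe e0; apply: cauchy_cvg; apply: cauchy_exP => eps eps0.
have /cvgrPdist_lt/(_ _ eps0) := e0 => -[k _ kP].
exists (x k), k => //= n kn; rewrite /= -ball_normE /ball_/=.
rewrite (le_lt_trans (xe _ _ kn))// (le_lt_trans (ler_norm _))//.
by rewrite -normrN -sub0r; apply: kP => /=.
Qed.

Lemma cvg_half_expr (M : R) : 2^-1 ^+ n * M @[n --> \oo] --> (0 : R).
Proof.
rewrite -(mul0r M); apply: cvgMr_tmp; apply: cvg_expr.
by rewrite ger0_norm; lra.
Qed.

End cauchy_rate.

(** * Countably many functionals that separate points *)

Section separating_sequence.
Context {R : realType} {X : normedModType R}.

Definition dense_seq (c : nat -> X) := forall x (e : R), 0 < e -> exists j, `|x - c j| < e.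

Lemma separable_dense_seq : separable_space X -> exists c, dense_seq c.
Proof.
move=> [S /(@pcard_surjP X) [c cS] dS].
exists c => x e e0; have [] := dS (ball x e) _ (ball_open x e).
  by exists x; exact: ballxx.
by move=> y [xy /cS[j _ cj]]; exists j; rewrite cj; move: xy; rewrite -ball_normE.
Qed.

(** Take [f j] norming [c j]. If all of them vanish at [x], then |c j| = [f j (c j - x)] <= |x - c
    j|, so |x| <= 2 |x - c j|, which density makes arbitrarily small. *)
Lemma separating_seq (c : nat -> X) : dense_seq c -> exists2 f : nat -> dual X,
  (forall j x, `|f j x| <= `|x|) & forall x, (forall j, f j x = 0) -> x = 0.
Proof.
move=> cd; have /choice[f fP] : forall j, exists f : dual X,
    (forall x, `|f x| <= `|x|) /\ f (c j) = `|c j|.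
  by move=> j; have [f] := norming_functional (c j); exists f.
exists f => [j x|x fx0]; first by have [] := fP j.
apply/eqP; rewrite -normr_le0; apply/ler_addgt0Pl => e e0; rewrite addr0.
have e2 : 0 < e / 2 by rewrite divr_gt0.
have [j xj] := cd x _ e2; have [fj fjc] := fP j.
have := fj (c j - x); rewrite dualB fx0 subr0 fjc normr_id distrC => cx.
by have := ler_normD (x - c j) (c j); rewrite subrK => /le_trans; apply; lra.
Qed.

(** Along any ultrafilter [v] has a weak limit, and every [f j] vanishes at it. Weak nullity thus
    becomes countably many conditions, which an inductive choice of terms can meet. *)
Lemma separating_weakly_null (f : nat -> dual X) (v : nat -> X) (M : R) :
  reflexive_space X -> (forall x, (forall j, f j x = 0) -> x = 0) ->
  (forall n, `|v n| <= M) -> (forall j, f j (v n) @[n --> \oo] --> (0 : R)) -> weakly_null v.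
Proof.
move=> refX fsep vM fv g; apply: cvg_of_ultra => U uU Uoo.
have [w wP] := @weak_ultralimit _ _ _ U v M refX uU (@filterE _ _ _ _ vM).
have <- : g w = 0.
  rewrite (fsep w) ?dual0// => j.
  apply: (@cvg_unique _ _ _ _ _ _ (wP (f j))) => //.
  by apply: cvg_trans (fv j); apply: cvg_app.
exact: wP.
Qed.

End separating_sequence.

Lemma filter_le_cvg (R : realType) (I : Type) (F : set_system I) (a b : I -> R) (l l' : R) :
  ProperFilter F -> a i @[i --> F] --> l -> b i @[i --> F] --> l' ->
  (\forall i \near F, a i <= b i) -> l <= l'.
Proof.
move=> pF al bl ab; rewrite -subr_ge0.
have cl : (b i - a i) @[i --> F] --> l' - l by apply: cvgB.
rewrite -(cvg_lim _ cl)//; apply: limr_ge; first exact: cvgP cl.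
by apply: filterS ab => i; rewrite subr_ge0.
Qed.

(** * Ultralimits of norms *)

Section ultralimit_norm.
Context {R : realType} {X : normedModType R} {I : Type} (U : set_system I) {uU : UltraFilter U}.
Implicit Types (c : X) (u : I -> X).

Definition ulim (a : I -> R) : R := lim (a i @[i --> U]).

Lemma ulim_cvg (a : I -> R) (M : R) : (\forall i \near U, `|a i| <= M) ->
  a i @[i --> U] --> ulim a.
Proof. by move=> aM; have [l _ al] := ultra_bounded_cvg uU aM; apply: cvgP al. Qed.

(** The type, in the sense of Krivine and Maurey, that a bounded family [u] defines along [U]. *)
Definition ultra_norm u c : R := ulim (fun i => `|c + u i|).

Lemma ultra_norm_cvg u (M : R) c : (\forall i \near U, `|u i| <= M) ->
  `|c + u i| @[i --> U] --> ultra_norm u c.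
Proof.
move=> uM; apply: (@ulim_cvg _ (`|c| + M)); apply: filterS uM => i ui.
by rewrite normr_id (le_trans (ler_normD _ _))// lerD2l.
Qed.

Lemma ultra_norm_near u (M : R) c (e : R) : (\forall i \near U, `|u i| <= M) -> 0 < e ->
  \forall i \near U, ultra_norm u c - e < `|c + u i| < ultra_norm u c + e.
Proof.
move=> uM e0; have /cvgrPdist_lt/(_ e e0) := ultra_norm_cvg (c := c) uM.
by apply: filterS => i; rewrite distrC ltr_distl.
Qed.

End ultralimit_norm.

(** * Asymptotically additive weakly null families tend to 0 *)

Section asymptotically_additive.
Context {R : realType} {X : completeNormedModType R}.

(* [2^-k Z k] is a partial sum of [sum_i 2^-(i+1) v i]; its limit [y] has so large a norm that the
   norming functional [f] of [y] keeps the tails [B k] of [sum_i 2^(k-i-1) f (v i)] above [d / 2],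
   whereas [B k.+1 = 2 B k - f (v k)] blows up if [f (v k)] tends to 0. *)
Lemma doubling_sequence_contra (v Z : nat -> X) (t : nat -> R) (M d : R) :
  0 < d -> (forall k, `|v k| <= M) -> weakly_null v ->
  Z 0 = 0 -> (forall k, Z k.+1 = 2 *: Z k + v k) ->
  d <= t 0 -> (forall k, t k <= `|Z k| + M) ->
  (forall k, 2 * t k - 2^-1 ^+ k * (d / 10) <= t k.+1) ->
  (forall k, `|Z k + v k| <= t k + 2^-1 ^+ k * (d / 10)) -> False.
Proof.
move=> d0 vM vw Z0 ZS dt0 tZ tS tv.
pose h := fun k => 2^-1 ^+ k : R; have hS k : h k.+1 = h k / 2 by rewrite /h exprSr.
have h0 k : 0 < h k by rewrite /h exprn_gt0// invr_gt0.
have h2 k : h k * 2 ^+ k = 1 by rewrite /h -exprMn mulVf ?expr1n// pnatr_eq0.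
pose z k := h k *: Z k.
have M0 : 0 <= M := le_trans (normr_ge0 _) (vM 0).
have zS k : z k.+1 = z k + h k.+1 *: v k.
  by rewrite /z ZS scalerDr scalerA hS -mulrA mulVf ?mulr1// pnatr_eq0.
have zk k n : (k <= n)%N -> `|z k - z n| <= h k * M.
  suff D m : `|z k - z (k + m)%N| <= (h k - h (k + m)%N) * M.
    move=> kn; have := D (n - k)%N; rewrite subnKC// => /le_trans; apply.
    by rewrite ler_wpM2r// gerBl ltW.
  elim: m => [|m IH]; first by rewrite addn0 !subrr normr0 mul0r.
  rewrite addnS zS opprD addrA (le_trans (ler_normB _ _))//.
  rewrite (le_trans (lerD IH (_ : _ <= h (k + m).+1 * M)))//.
    by rewrite normrZ gtr0_norm// ler_pM2l.
  by rewrite hS; have := h0 (k + m)%N; nra.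
have /cvg_ex[y /= zy] := cauchy_rate_cvg zk (cvg_half_expr M).
have {zk} zk k : `|Z k - 2 ^+ k *: y| <= M.
  rewrite -(ler_pM2l (h0 k)) -[X in X * `|_|](gtr0_norm (h0 k)) -normrZ scalerBr scalerA h2
    scale1r.
  exact: cvg_rate zk zy k.
(* The correction makes [h k * t k] nondecreasing: a doubling loses at most half of the correction,
   which itself shrinks by three quarters. *)
pose s k := h k * t k - h k * (h k * (d / 10)).
have s_mono : {homo s : m n / (m <= n)%N >-> m <= n}.
  apply/nondecreasing_seqP => k; rewrite /s hS.
  have /(ler_wpM2l (ltW (h0 k))) := tS k; rewrite -/(h k).
  by have := mulr_gt0 (mulr_gt0 (h0 k) (h0 k)) d0; nra.
have ty k : t k - h k * (d / 10) <= 2 ^+ k * `|y|.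
  rewrite -(ler_pM2l (h0 k)) [leRHS]mulrA h2 mul1r mulrBr -/(s k).
  have sy n : (k <= n)%N -> s k <= `|y| + h n * (2 * M).
    move=> /s_mono /le_trans; apply.
    have /(ler_wpM2l (ltW (h0 n))) := tZ n.
    have -> : `|y| = h n * `|2 ^+ n *: y| by rewrite normrZ gtr0_norm ?exprn_gt0// mulrA h2 mul1r.
    have /(ler_wpM2l (ltW (h0 n))) := le_trans (lerB_dist _ _) (zk n).
    by have := mulr_gt0 (mulr_gt0 (h0 n) (h0 n)) d0; rewrite /s; nra.
  have hl : `|y| + h n * (2 * M) @[n --> \oo] --> `|y|.
    by rewrite -[X in _ --> X]addr0; apply: cvgD; [exact: cvg_cst|exact: cvg_half_expr].
  apply: (filter_le_cvg _ (cvg_cst (s k)) hl).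
  by exists k => // n; exact: sy.
have [f f1 fy] := norming_functional y.
pose B (k : nat) : R := 2 ^+ k * `|y| - f (Z k).
have BS k : B k.+1 = 2 * B k - f (v k).
  by rewrite /B ZS dualD dualZ exprS; ring.
have Bv k : f (v k) - 2 * h k * (d / 10) <= B k.
  have := ty k; have := tv k; have := le_trans (ler_norm _) (f1 (Z k + v k)).
  by rewrite dualD -/(h k) /B; lra.
(* By [Bv], passing from [B k] to [B k.+1] loses at most [2 * h k * (d / 10)], in total less than
   [4 * (d / 10)]; together with the loss [d / 10] at the start, [d / 2] remains. *)
have Bd k : d / 2 <= B k.
  suff : d - d / 10 - 4 * (d / 10) * (1 - h k) <= B k by have := h0 k; nra.
  elim: k => [|k IH].
    by rewrite /B Z0 dual0; have := ty 0%N; rewrite /h !expr0; lra.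
  by rewrite BS hS; have := Bv k; lra.
have BM k : B k <= M.
  have -> : B k = f (2 ^+ k *: y - Z k) by rewrite dualB dualZ fy.
  by rewrite (le_trans (ler_norm _))// (le_trans (f1 _))// distrC.
have /cvgrPdist_lt/(_ (d / 4)) := vw f.
case; first by rewrite divr_gt0.
move=> K _ KP.
(* From [K] on, [f (v k) < d / 4], so [2 * B - f (v k)] exceeds [B] by at least [d / 2 - d / 4]. *)
have Bgrow n : d / 4 * n%:R <= B (K + n)%N.
  elim: n => [|n IH]; first by rewrite mulr0 (le_trans _ (Bd _))// ltW// divr_gt0.
  have := KP (K + n)%N (leq_addr _ _); rewrite sub0r normrN => /(le_lt_trans (ler_norm _)).
  have -> : d / 4 * n.+1%:R = d / 4 * n%:R + d / 4 by rewrite -(natr1 n) mulrDr mulr1.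
  by rewrite addnS BS; have := Bd (K + n)%N; lra.
have := archi_boundP (divr_ge0 M0 (ltW (divr_gt0 d0 (ltr0n R 4)))).
rewrite ltr_pdivrMr ?divr_gt0// mulrC => /lt_le_trans/(_ (Bgrow _)).
by rewrite ltNge BM.
Qed.

End asymptotically_additive.

Section asymptotically_additive_ultra.
Context {R : realType} {X : completeNormedModType R} {I : Type} (U : set_system I)
  {uU : UltraFilter U}.

Definition asymptotically_additive (u : I -> X) := forall c (e : R), 0 < e ->
  \forall m \near U, \forall n \near U, `|c + u m| + `|c + u n| - `|2 *: c + u m + u n| < e.

(** With [m] fixed, the limit in [n] turns the two-variable condition into an almost doubling of the
    type. Four approximations cost [e / 4] each. *)
Lemma asymptotically_additive_ultra_norm (u : I -> X) (M : R) c (e : R) :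
  (\forall i \near U, `|u i| <= M) -> asymptotically_additive u -> 0 < e ->
  \forall m \near U, 2 * ultra_norm U u c - e < ultra_norm U u (2 *: c + u m).
Proof.
move=> uM au e0; have e3 : 0 < e / 4 by rewrite divr_gt0.
apply: filterS2 (au c _ e3) (ultra_norm_near c uM e3) => m cm /andP[cm1 _].
have [n [cn [/andP[cn1 _] /andP[_ cn2]]]] := filter_ex (filterI cm
  (filterI (ultra_norm_near c uM e3) (ultra_norm_near (2 *: c + u m) uM e3))).
move: cn; lra.
Qed.

Lemma asymptotically_additive_cvg0 (u : I -> X) (M : R) (sepX : separable_space X) :
  reflexive_space X -> (\forall i \near U, `|u i| <= M) ->
  (forall f : dual X, f (u i) @[i --> U] --> (0 : R)) -> asymptotically_additive u ->
  `|u i| @[i --> U] --> (0 : R).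
Proof.
move=> refX uM u0 au; pose t c := ultra_norm U u c.
have t0cvg : `|u i| @[i --> U] --> t 0.
  have -> : (fun i => `|u i|) = fun i => `|0 + u i| by apply/funext => i; rewrite add0r.
  exact: ultra_norm_cvg uM.
have t00 : 0 <= t 0.
  by apply: (filter_le_cvg _ (cvg_cst 0) t0cvg); apply: filterE => i.
move: t00; rewrite le_eqVlt => /predU1P[t00|d0]; first by rewrite [X in _ --> X]t00.
exfalso; have [c /separating_seq[f f1 fsep]] := separable_dense_seq sepX.
pose eta k : R := 2^-1 ^+ k * (t 0 / 10).
have eta0 k : 0 < eta k by rewrite /eta mulr_gt0 ?divr_gt0// exprn_gt0// invr_gt0.
(* The first three conditions feed [doubling_sequence_contra]; the fourth controls the first [k]
   separating functionals, so that the chosen terms are weakly null. *)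
pose P k Z i := [/\ `|u i| <= M, 2 * t Z - eta k <= t (2 *: Z + u i),
  `|Z + u i| <= t Z + eta k & forall j : 'I_k, `|f j (u i)| <= eta k].
have /choice[g gP] : forall kZ : nat * X, exists i, P kZ.1 kZ.2 i.
  move=> [k Z] /=; apply: (@filter_ex _ U).
  have near_f : \forall i \near U, forall j : 'I_k, `|f j (u i)| <= eta k.
    apply: filter_forall => j; have /cvgrPdist_lt/(_ _ (eta0 k)) := u0 (f j).
    by apply: filterS => i; rewrite sub0r normrN => /ltW.
  near=> i; split.
  - by near: i.
  - by apply/ltW; near: i; exact: asymptotically_additive_ultra_norm uM au _.
  - by near: i; apply: filterS (ultra_norm_near Z uM (eta0 k)) => i /andP[_ /ltW].
  - by near: i.
pose Z := fix Z k := if k is k'.+1 then 2 *: Z k' + u (g (k', Z k')) else 0.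
pose v k := u (g (k, Z k)).
apply: (@doubling_sequence_contra R X v Z (fun k => t (Z k)) M (t 0)) => //.
- by move=> k; have [] := gP (k, Z k).
- apply: (@separating_weakly_null _ _ f v M refX fsep) => [k|j].
    by have [] := gP (k, Z k).
  apply/cvgrPdist_lt => e e0.
  have /cvgrPdist_lt/(_ _ e0) := cvg_half_expr (t 0 / 10).
  apply: filter_app; near=> k.
  rewrite !sub0r !normrN; apply: le_lt_trans.
  have jk : (j < k)%N by near: k; exact: nbhs_infty_gt.
  by have [_ _ _ /(_ (Ordinal jk))/le_trans] := gP (k, Z k); apply; rewrite ler_norm.
- move=> k; apply: (filter_le_cvg _ (ultra_norm_cvg (c := Z k) uM) (cvg_cst _)).
  by apply: filterS uM => i ui; rewrite (le_trans (ler_normD _ _))// lerD2l.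
- by move=> k; have [_ ] := gP (k, Z k).
- by move=> k; have [_ _] := gP (k, Z k).
Unshelve. all: by end_near. Qed.

End asymptotically_additive_ultra.

(** * Equivalent norms and two-sided bounds *)

Section equivalent_norms.
Context {R : realType} {X : normedModType R}.
Implicit Types (N p q : X -> R) (x y : X).

Lemma is_norm_seminorm N : is_norm N -> seminorm N.
Proof. by case. Qed.

(** Rescale [x] to [q]-value [e / 2], strictly below the threshold. *)
Lemma seminorm_unit_bound p q (e : R) : seminorm p -> seminorm q ->
  (forall x, q x = 0 -> x = 0) -> 0 < e -> (forall x, q x < e -> p x < 1) ->
  forall x, p x <= 2 / e * q x.
Proof.
move=> sp sq q0 e0 qp x; have [/q0 ->|nq] := eqVneq (q x) 0.
  by rewrite -(scale0r 0) sp.2 sq.2 normr0 !mul0r mulr0.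
have qx : 0 < q x by rewrite lt_neqAle eq_sym nq seminorm_ge0.
have a0 : 0 < e / (2 * q x) by rewrite divr_gt0// mulr_gt0.
have := qp ((e / (2 * q x)) *: x).
rewrite sp.2 sq.2 gtr0_norm// => /(_ _)/ltW.
rewrite -ler_pdivlMl// mulr1 invf_div => h; rewrite [leRHS]mulrAC; apply: h.
have -> : e / (2 * q x) * q x = e / 2 by field.
by rewrite ltr_pdivrMr// ltr_pMr// ltr1n.
Qed.

Lemma equivalent_norm_bounds N : equivalent_norm N ->
  exists A B : R, [/\ 0 < A, 0 < B, forall x, N x <= A * `|x| & forall x, `|x| <= B * N x].
Proof.
move=> [nN oN]; have sN := is_norm_seminorm nN.
have [e e0 eN] : exists2 e : R, 0 < e & forall x, N x < e -> `|x| < 1.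
  have /oN/(_ 0 (ballxx _ ltr01))[e e0 eN] : open (ball (0 : X) 1) by exact: ball_open.
  exists e => // x xe; have := eN x; rewrite subr0 => /(_ xe).
  by rewrite -ball_normE /ball_/= sub0r normrN.
have [d d0 dN] : exists2 d : R, 0 < d & forall x, `|x| < d -> N x < 1.
  have /oN : norm_open N [set x | N x < 1].
    move=> x /= x1; exists (1 - N x); first by rewrite subr_gt0.
    by move=> y; have := sN.1 (y - x) x; rewrite subrK; lra.
  rewrite openE => /(_ 0); rewrite /= -{1}(scale0r 0) sN.2 normr0 mul0r => /(_ ltr01).
  move=> /nbhs_ballP[d /= d0 dN]; exists d => // x xd; apply: dN.
  by rewrite -ball_normE /ball_/= sub0r normrN.
exists (2 / d), (2 / e); split; rewrite ?divr_gt0//.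
  apply: (seminorm_unit_bound sN seminorm_normr) => // x.
  by move=> /eqP; rewrite normr_eq0 => /eqP.
apply: (seminorm_unit_bound seminorm_normr sN) => //.
by case: nN.
Qed.

Lemma bounds_equivalent_norm N (A B : R) : seminorm N -> 0 < A -> 0 < B ->
  (forall x, N x <= A * `|x|) -> (forall x, `|x| <= B * N x) -> equivalent_norm N.
Proof.
move=> sN A0 B0 NA NB; split.
  split; [exact: sN.1|exact: sN.2|move=> x Nx0].
  by apply/eqP; rewrite -normr_le0 (le_trans (NB x))// Nx0 mulr0.
move=> O; split=> [|oO].
  rewrite openE => oO x /oO/nbhs_ballP[e /= e0 eO]; exists (e / B); first by rewrite divr_gt0.
  move=> y; rewrite ltr_pdivlMr// mulrC => Ny; apply: eO.
  by rewrite -ball_normE /ball_/= distrC (le_lt_trans (NB _)).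
rewrite openE => x /oO[e e0 eO]; apply/nbhs_ballP.
exists (e / A) => /=; first by rewrite divr_gt0.
move=> y; rewrite -ball_normE /ball_/= distrC ltr_pdivlMr// mulrC => Ny; apply: eO.
exact: le_lt_trans (NA _) Ny.
Qed.

End equivalent_norms.

(** * Series of seminorms *)

Section seminorm_series.
Context {R : realType} {X : normedModType R}.
Variables (w : nat -> X -> R) (K : R).
Hypotheses (sw : forall j, seminorm (w j)) (wK : forall j x, w j x <= 2^-1 ^+ j.+1 * (K * `|x|)).

Definition seminorm_sum x : R := limn (series (fun j => w j x)).

Lemma half_series_le (M : R) n : 0 <= M -> series (fun j => 2^-1 ^+ j.+1 * M) n <= M.
Proof.
move=> M0; rewrite /series/= -mulr_suml ler_piMl//.
suff -> : \sum_(0 <= k < n) 2^-1 ^+ k.+1 = 1 - 2^-1 ^+ n :> R.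
  by rewrite gerBl exprn_ge0// invr_ge0.
elim: n => [|n IH]; first by rewrite big_geq// expr0 subrr.
by rewrite big_nat_recr//= IH exprS; field.
Qed.

Lemma seminorm_series_le x n : series (fun j => w j x) n <= K * `|x|.
Proof.
have K0 : 0 <= K * `|x|.
  by have := le_trans (seminorm_ge0 x (sw 0)) (wK 0 x); rewrite pmulr_rge0// exprn_gt0// invr_gt0.
rewrite (le_trans _ (half_series_le n K0))//; apply: ler_sum => j _; exact: wK.
Qed.

Lemma seminorm_series_cvg x : series (fun j => w j x) n @[n --> \oo] --> seminorm_sum x.
Proof.
apply: nondecreasing_is_cvgn.
  by apply/nondecreasing_seqP => n; rewrite seriesSr lerDl seminorm_ge0.
by exists (K * `|x|) => _ [n _ <-]; exact: seminorm_series_le.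
Qed.

Lemma seminorm_sum_le x : seminorm_sum x <= K * `|x|.
Proof.
apply: (filter_le_cvg _ (seminorm_series_cvg (x := x)) (cvg_cst _)).
by apply: filterE => n; exact: seminorm_series_le.
Qed.

Lemma series_ge_term (g : nat -> R) j n : (forall i, 0 <= g i) -> (j < n)%N -> g j <= series g n.
Proof.
move=> g0 jn; rewrite /series/= (bigD1_seq j) ?mem_index_iota//= ?iota_uniq//.
by rewrite lerDl sumr_ge0.
Qed.

(** The triangle defects [g i] of the terms are nonnegative, so the defect of the sum dominates each
    of them. Hence near-equality in the triangle inequality of the sum passes to every term. *)
Lemma seminorm_sum_rest j : seminorm (fun x => seminorm_sum x - w j x).
Proof.
split=> [x y|a x].
  pose g i := w i x + w i y - w i (x + y).
  have g0 i : 0 <= g i by rewrite subr_ge0 (sw i).1.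
  have gE n : series g n = series (w ^~ x) n + series (w ^~ y) n - series (w ^~ (x + y)) n.
    by rewrite /series/= -big_split -sumrB.
  have gl : series g n @[n --> \oo] --> seminorm_sum x + seminorm_sum y - seminorm_sum (x + y).
    rewrite (_ : series g = fun n => series (w ^~ x) n +
      series (w ^~ y) n - series (w ^~ (x + y)) n); last exact/funext.
    by apply: cvgB; [apply: cvgD|]; exact: seminorm_series_cvg.
  suff : g j <= seminorm_sum x + seminorm_sum y - seminorm_sum (x + y) by rewrite /g; lra.
  apply: (filter_le_cvg _ (cvg_cst _) gl); exists j.+1 => // n; exact: series_ge_term.
rewrite (sw j).2 mulrBr; congr (_ - _).
apply: cvg_lim => //; rewrite (_ : series _ = fun n => `|a| * series (w ^~ x) n).
  by apply: cvgMl_tmp; exact: seminorm_series_cvg.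
by apply/funext => n; rewrite /series/= big_distrr/=; apply: eq_bigr => i _; rewrite (sw i).2.
Qed.

Lemma seminorm_sumP : seminorm seminorm_sum.
Proof.
have [rD rZ] := seminorm_sum_rest 0; have [wD wZ] := sw 0; split=> [x y|a x].
  by have := lerD (rD x y) (wD x y); rewrite subrK; lra.
by have := rZ a x; rewrite wZ; lra.
Qed.

Lemma seminorm_sum_ge_term j x : w j x <= seminorm_sum x.
Proof. by rewrite -subr_ge0; exact: seminorm_ge0 (seminorm_sum_rest j). Qed.

End seminorm_series.

(** * The seminorm attached to one direction *)

Section directional_norm.
Context {R : realType} {X : normedModType R}.
Implicit Types (c x y z : X) (s t : R).

Definition sym_norm c t z : R := `|t *: c + z| + `|t *: c - z|.

(** As a function of its scalar, [sym_norm] is even and convex, hence nondecreasing on the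
    nonnegative reals; [comb] expresses [s] as a convex combination of [t] and [- t]. *)
Lemma sym_norm_mono c s t z : 0 <= s -> s <= t -> sym_norm c s z <= sym_norm c t z.
Proof.
move=> s0 st; have := le_trans s0 st; rewrite le_eqVlt => /predU1P[t0|t0].
  by rewrite (_ : s = t)//; apply/eqP; rewrite eq_le st -t0 s0.
have comb y : (2 * t) *: (s *: c + y) = (t + s) *: (t *: c + y) - (t - s) *: (t *: c - y).
  rewrite 2!scalerDr scalerBr opprB [X in _ = _ + X]addrC addrACA -!scalerDl -scalerBl !scalerA.
  by congr (_ *: _ + _ *: _); ring.
have half y : (2 * t) * `|s *: c + y| <= (t + s) * `|t *: c + y| + (t - s) * `|t *: c - y|.
  have t2 : 0 <= 2 * t by rewrite mulr_ge0// ltW.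
  have ts : 0 <= t + s by rewrite addr_ge0// ltW.
  have ts' : 0 <= t - s by rewrite subr_ge0.
  rewrite -[X in X * _ <= _](ger0_norm t2) -[X in X * _ + _](ger0_norm ts).
  rewrite -[X in _ + X * _](ger0_norm ts') -!normrZ comb.
  exact: ler_normB.
have := half z; have := half (- z); rewrite opprK => h1 h2.
by rewrite -(ler_pM2l t0) /sym_norm; lra.
Qed.

Lemma sym_norm_triangle c s t x y :
  sym_norm c (s + t) (x + y) <= sym_norm c s x + sym_norm c t y.
Proof.
rewrite /sym_norm addrACA lerD// scalerDl ?opprD addrACA; exact: ler_normD.
Qed.

Definition directional_norm c x : R := sym_norm c `|x| x.

(** Monotonicity replaces |x + y| by |x| + |y| in the norm of the sum; the halves with the minus
    sign then have a nonnegative triangle defect, which is dropped. *)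
Lemma directional_norm_gap c x y :
  `| `|x| *: c + x| + `| `|y| *: c + y| - `|(`|x| + `|y|) *: c + (x + y)| <=
  directional_norm c x + directional_norm c y - directional_norm c (x + y).
Proof.
have := sym_norm_mono c (x + y) (normr_ge0 _) (ler_normD x y).
rewrite /directional_norm /sym_norm.
have := ler_normD (`|x| *: c - x) (`|y| *: c - y).
by rewrite addrACA -opprD -scalerDl; lra.
Qed.

Lemma directional_norm_seminorm c : seminorm (directional_norm c).
Proof.
split=> [x y|a x].
  by rewrite (le_trans (sym_norm_mono _ _ _ (ler_normD x y)))// sym_norm_triangle.
rewrite /directional_norm /sym_norm normrZ.
have [a0|a0] := leP 0 a.
  by rewrite ger0_norm// -scalerA -scalerBr -scalerDr !normrZ ger0_norm// mulrDr.
rewrite ltr0_norm// -scalerA -[a *: x]opprK -scaleNr opprK addrC.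
rewrite -scalerBr -scalerDr !normrZ ger0_norm ?oppr_ge0 ?ltW//.
by rewrite -mulrDr.
Qed.

Lemma directional_norm_le c x : directional_norm c x <= 2 * (1 + `|c|) * `|x|.
Proof.
rewrite /directional_norm /sym_norm.
have := ler_normD (`|x| *: c) x; have := ler_normB (`|x| *: c) x.
by rewrite normrZ normr_id; lra.
Qed.

Lemma directional_norm_ge c x : 2 * `|x| <= directional_norm c x.
Proof.
have := ler_normB (`|x| *: c + x) (`|x| *: c - x).
rewrite opprB addrC addrA subrK -mulr2n -scaler_nat normrZ normr_nat.
by [].
Qed.

End directional_norm.

(** * The renorming by a sequence of directions *)

Section renorming.
Context {R : realType} {X : normedModType R}.
Implicit Types (c : nat -> X) (x y : X).

(** The denominator cancels the bound of [directional_norm_le], so the weighted terms are summable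
    uniformly on bounded sets. *)
Definition direction_weight (c : nat -> X) j : R := 2^-1 ^+ j.+1 / (1 + `|c j|).

Lemma direction_weight_gt0 c j : 0 < direction_weight c j.
Proof. by rewrite divr_gt0 ?exprn_gt0 ?invr_gt0// ltr_pwDl. Qed.

Definition renorm_term (c : nat -> X) j x := direction_weight c j * directional_norm (c j) x.

Lemma renorm_term_seminorm c j : seminorm (renorm_term c j).
Proof.
have [qD qZ] := directional_norm_seminorm (c j); split=> [x y|a x]; rewrite /renorm_term.
  by rewrite -mulrDr ler_pM2l ?direction_weight_gt0.
by rewrite qZ mulrCA.
Qed.

Lemma renorm_term_le c j x : renorm_term c j x <= 2^-1 ^+ j.+1 * (2 * `|x|).
Proof.
rewrite /renorm_term /direction_weight -mulrA ler_pM2l ?exprn_gt0 ?invr_gt0//.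
have c0 : 0 < 1 + `|c j| by rewrite ltr_pwDl.
by rewrite mulrC ler_pdivrMr// (le_trans (directional_norm_le _ _))//; lra.
Qed.

Definition renorm (c : nat -> X) : X -> R := seminorm_sum (renorm_term c).

Lemma renorm_seminorm c : seminorm (renorm c).
Proof. exact: seminorm_sumP (renorm_term_seminorm c) (renorm_term_le c). Qed.

Lemma renorm_rest c j : seminorm (fun x => renorm c x - renorm_term c j x).
Proof. exact: seminorm_sum_rest (renorm_term_seminorm c) (renorm_term_le c) j. Qed.

Lemma renorm_le c x : renorm c x <= 2 * `|x|.
Proof. exact: seminorm_sum_le (renorm_term_seminorm c) (renorm_term_le c) x. Qed.

(** The term of index 0 alone bounds the norm from below, through [directional_norm_ge], with
    constant 1 + |c 0|. *)
Lemma renorm_equivalent c : equivalent_norm (renorm c).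
Proof.
have c0 : 0 < 1 + `|c 0| by rewrite ltr_pwDl.
apply: (bounds_equivalent_norm (renorm_seminorm c) (ltr0n R 2) c0 (renorm_le c)) => x.
have := seminorm_sum_ge_term (renorm_term_seminorm c) (renorm_term_le c) 0 x.
rewrite -/(renorm c) /renorm_term /direction_weight expr1.
have := directional_norm_ge (c 0) x.
rewrite -[X in X <= renorm _ _]mulrA [X in 2^-1 * X <= _]mulrC mulrA => h.
rewrite ler_pdivrMr// => hN; rewrite [leRHS]mulrC (le_trans _ hN)//; lra.
Qed.

Lemma renorm_gap c j x y :
  direction_weight c j *
    (`| `|x| *: c j + x| + `| `|y| *: c j + y| - `|(`|x| + `|y|) *: c j + (x + y)|) <=
  renorm c x + renorm c y - renorm c (x + y).
Proof.
have := (renorm_rest c j).1 x y.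
have := ler_wpM2l (ltW (direction_weight_gt0 c j)) (directional_norm_gap (c j) x y).
by rewrite /renorm_term; lra.
Qed.

End renorming.

(** * Defects in arbitrary directions and strict convexity *)

Section directional_gap.
Context {R : realType} {X : normedModType R}.

Definition directional_gap (c x y : X) : R :=
  `| `|x| *: c + x| + `| `|y| *: c + y| - `|(`|x| + `|y|) *: c + (x + y)|.

Lemma normr_scale_lip (t : R) (c d z : X) : 0 <= t ->
  `|t *: c + z| <= `|t *: d + z| + t * `|c - d|.
Proof.
move=> t0; rewrite -[X in X * _](ger0_norm t0) -normrZ (le_trans _ (ler_normD _ _))//.
by rewrite scalerBr [t *: c - _]addrC addrA [t *: d + z]addrC addrK addrC.
Qed.

Lemma directional_gap_lip (c d x y : X) :
  directional_gap c x y <= directional_gap d x y + 2 * (`|x| + `|y|) * `|c - d|.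
Proof.
have := normr_scale_lip c d x (normr_ge0 x).
have := normr_scale_lip c d y (normr_ge0 y).
have := normr_scale_lip d c (x + y) (addr_ge0 (normr_ge0 x) (normr_ge0 y)).
by rewrite (distrC d) /directional_gap; lra.
Qed.

(** On the ball of radius [M] the gap is Lipschitz in the direction with constant [4 * M], so a
    close enough [c j] stands in for [b] at cost below [e / 2]; [renorm_gap] controls the other
    half. *)
Lemma renorm_directional_gap (c : nat -> X) (M : R) b (e : R) : dense_seq c -> 0 <= M -> 0 < e ->
  exists2 d : R, 0 < d & forall x y, `|x| <= M -> `|y| <= M ->
    renorm c x + renorm c y - renorm c (x + y) < d -> directional_gap b x y < e.
Proof.
move=> cd M0 e0.
have d0 : 0 < e / 2 / (4 * M + 1) by rewrite !divr_gt0// ltr_wpDl// mulr_ge0.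
have [j bj] := cd b _ d0.
exists (direction_weight c j * (e / 2)).
  by rewrite mulr_gt0 ?direction_weight_gt0 ?divr_gt0.
move=> x y xM yM /(le_lt_trans (renorm_gap c j _ _)).
rewrite ltr_pM2l ?direction_weight_gt0// -/(directional_gap (c j) x y).
have := directional_gap_lip b (c j) x y.
move: bj; rewrite ltr_pdivlMr ?ltr_wpDl ?mulr_ge0//.
by have := normr_ge0 (b - c j); nra.
Qed.

(** The direction [b] is chosen so that the norm subtracted in the gap vanishes. A zero gap then
    forces [x] and [y] to be the multiples - |x| b and - |y| b, and equality of their new norms
    makes them equal. *)
Lemma renorm_strictly_convex (c : nat -> X) x y : dense_seq c ->
  renorm c x = renorm c y -> renorm c (x + y) = renorm c x + renorm c y -> x = y.
Proof.
move=> cd xy sum; pose s := `|x| + `|y|.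
have [s0|s0] := eqVneq s 0.
  move/eqP: s0; rewrite paddr_eq0// !normr_eq0 => /andP[/eqP -> /eqP ->//].
pose b := - s^-1 *: (x + y).
have M0 : 0 <= s by rewrite addr_ge0.
have gap0 : directional_gap b x y <= 0.
  apply/ler_addgt0Pl => e e0; rewrite addr0; have [d d0 dP] := renorm_directional_gap b cd M0 e0.
  apply: ltW; apply: dP; rewrite ?lerDl ?lerDr//.
  by rewrite sum subrr.
have : directional_gap b x y = `| `|x| *: b + x| + `| `|y| *: b + y|.
  have sb : s *: b = - (x + y) by rewrite /b scalerA mulrN divff// scaleN1r.
  by rewrite /directional_gap -/s sb addNr normr0 subr0.
move=> gapE; move: gap0; rewrite gapE => gap0.
have /eqP := gap0; have := normr_ge0 (`|x| *: b + x); have := normr_ge0 (`|y| *: b + y).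
move=> hy hx _.
have /normr0_eq0/eqP : `| `|x| *: b + x| = 0 by lra.
have /normr0_eq0/eqP : `| `|y| *: b + y| = 0 by lra.
rewrite !addr_eq0 => /eqP yb /eqP xb.
have [sD sZ] := renorm_seminorm c.
have Nx : renorm c x = `|x| * renorm c b.
  by rewrite -(seminormN x (renorm_seminorm c)) -xb sZ normr_id.
have Ny : renorm c y = `|y| * renorm c b.
  by rewrite -(seminormN y (renorm_seminorm c)) -yb sZ normr_id.
apply: oppr_inj; rewrite -xb -yb; have [b0|b0] := eqVneq b 0; first by rewrite b0 !scaler0.
have [[_ _ N0] _] := renorm_equivalent c.
have Nb : renorm c b != 0 by apply: contraNneq b0 => /N0 ->.
by congr (_ *: _); apply: (mulIf Nb); rewrite -Nx -Ny.
Qed.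

End directional_gap.

(** * Convergence of near-additive families *)

Section near_additive.
Context {R : realType} {X : completeNormedModType R} {I : Type} (U : set_system I)
  {uU : UltraFilter U}.

Definition near_additive (N : X -> R) (x : I -> X) := forall e : R, 0 < e ->
  \forall m \near U, \forall n \near U, N (x m) + N (x n) - N (x m + x n) < e.

Lemma near_additive_directional_gap (c : nat -> X) (x : I -> X) (M : R) b (e : R) :
  dense_seq c -> (\forall i \near U, `|x i| <= M) -> near_additive (renorm c) x -> 0 < e ->
  \forall m \near U, \forall n \near U, directional_gap b (x m) (x n) < e.
Proof.
move=> cd xM nx e0.
have M0 : 0 <= M by have [i] := filter_ex xM; exact: le_trans.
have [d d0 dP] := renorm_directional_gap b cd M0 e0.
apply: filterS2 (xM) (nx _ d0) => m xm; apply: filterS2 xM => n xn.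
exact: dP.
Qed.

(** Use the direction [a^-1 *: b]: since |x i| tends to [a], its multiple by |x i| tends to [b]. The
    replacement costs [e / 8] four times, on top of a gap below [e / 2]. *)
Lemma near_additive_asymptotically (c : nat -> X) (x : I -> X) (M a : R) :
  dense_seq c -> (\forall i \near U, `|x i| <= M) -> near_additive (renorm c) x ->
  0 < a -> `|x i| @[i --> U] --> a -> asymptotically_additive U x.
Proof.
move=> cd xM nx a0 xa b e e0.
have rl : `|x i| / a * `|b| - `|b| @[i --> U] --> (0 : R).
  rewrite -(subrr `|b|) -[X in _ --> X - _]mul1r -(divff (lt0r_neq0 a0)).
  by apply: cvgB; [apply: cvgMr_tmp; apply: cvgMr_tmp|exact: cvg_cst].
have e8 : 0 < e / 8 by rewrite divr_gt0.
have xb : \forall i \near U, `| `|x i| / a * `|b| - `|b| | < e / 8.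
  by have /cvgrPdist_lt/(_ _ e8) := rl; apply: filterS => i; rewrite sub0r normrN.
have e2 : 0 < e / 2 by rewrite divr_gt0.
have close i : `| (`|x i| *: (a^-1 *: b) + x i) - (b + x i)| = `| `|x i| / a * `|b| - `|b| |.
  rewrite opprD addrACA subrr addr0 scalerA -[X in _ - X]scale1r -scalerBl normrZ.
  rewrite -[X in _ = `|_ - X|]mul1r -mulrBl normrM normr_id//.
apply: filterS2 (xb) (near_additive_directional_gap (a^-1 *: b) cd xM nx e2) => m xm.
apply: filterS2 xb => n xn; rewrite /directional_gap.
move: xm xn; rewrite -!close => xm xn.
have hm := ler_distD (`|x m| *: (a^-1 *: b) + x m) (b + x m) 0.
have hn := ler_distD (`|x n| *: (a^-1 *: b) + x n) (b + x n) 0.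
have tri (p q p' q' : X) : `|p + q| <= `|p' + q'| + (`|p - p'| + `|q - q'|).
  rewrite (le_trans _ (lerD (lexx _) (ler_normD _ _)))// (le_trans _ (ler_normD _ _))//.
  by rewrite addrACA ![_ + (_ - _)]addrC !subrK.
have := tri (`|x m| *: (a^-1 *: b) + x m) (`|x n| *: (a^-1 *: b) + x n) (b + x m) (b + x n).
have -> : b + x m + (b + x n) = 2 *: b + x m + x n by rewrite addrACA addrA scaler_nat.
have -> : `|x m| *: (a^-1 *: b) + x m + (`|x n| *: (a^-1 *: b) + x n) =
  (`|x m| + `|x n|) *: (a^-1 *: b) + (x m + x n) by rewrite addrACA scalerDl.
rewrite !subr0 distrC in hm; rewrite !subr0 distrC in hn.
lra.
Qed.

Lemma near_additive_cvg (c : nat -> X) (x : I -> X) (M : R) : separable_space X ->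
  reflexive_space X -> dense_seq c -> (\forall i \near U, `|x i| <= M) ->
  near_additive (renorm c) x -> exists y : X, x i @[i --> U] --> y.
Proof.
move=> sepX refX cd xM nx; have [w wP] := weak_ultralimit refX uU xM.
have [a _ xa] : exists2 a, `|a| <= M & `|x i| @[i --> U] --> a.
  by apply: ultra_bounded_cvg; apply: filterS xM => i; rewrite normr_id.
have a0 : 0 <= a by apply: (filter_le_cvg _ (cvg_cst 0) xa); apply: filterE => i.
move: a0; rewrite le_eqVlt => /predU1P[a0|a0].
  by exists 0; apply/norm_cvg0P; rewrite a0.
(* Asymptotic additivity is demanded at every [b], hence it survives the translation by [w]. *)
have au : asymptotically_additive U (fun i => x i - w).
  move=> b e e0; have := near_additive_asymptotically cd xM nx a0 xa (b - w) e0.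
  apply: filterS => m; apply: filterS => n.
  have D i : b - w + x i = b + (x i - w) by rewrite -addrA [- w + _]addrC.
  have -> : 2 *: (b - w) + x m + x n = 2 *: b + (x m - w) + (x n - w).
    by rewrite !scaler_nat !mulr2n -addrA addrACA !D addrACA addrA.
  by rewrite !D.
have uM : \forall i \near U, `|x i - w| <= M + `|w|.
  by apply: filterS (xM) => i xi; rewrite (le_trans (ler_normB _ _))// lerD2r.
have u0 (f : dual X) : f (x i - w) @[i --> U] --> (0 : R).
  rewrite -(subrr (f w : R)).
  have -> : (fun i => f (x i - w)) = (fun i => f (x i) - f w) by apply/funext => i; rewrite dualB.
  by apply: cvgB; [exact: wP|exact: cvg_cst].
have := asymptotically_additive_cvg0 sepX refX uM u0 au.
move=> /(_ uU) h; exists w; apply/cvgrPdist_lt => e e0; have /cvgrPdist_lt/(_ e e0) := h.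
by apply: filterS => i; rewrite sub0r normrN normr_id distrC.
Qed.

End near_additive.

(** * Property (a) for the renorming *)

Section iterated_limits.
Context {R : realType}.

Lemma iterated_lim_near (u : nat -> nat -> R) (l e : R) : iterated_lim_to u l -> 0 < e ->
  \forall m \near \oo, \forall n \near \oo, `|u m n - l| < e.
Proof.
move=> [ucvg ul] e0; have e2 : 0 < e / 2 by rewrite divr_gt0.
have /cvgrPdist_lt/(_ _ e2) := ul; apply: filterS => m lm.
have /cvgrPdist_lt/(_ _ e2) := ucvg m; apply: filterS => n un.
by rewrite distrC in lm; rewrite distrC in un; have := ler_distD (limn (u m)) (u m n) l; lra.
Qed.

Lemma seminorm_cvg (X : normedModType R) (p : X -> R) (C : R) (I : Type) (F : set_system I)
    (x : I -> X) y : Filter F -> seminorm p -> (forall z, p z <= C * `|z|) ->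
  x i @[i --> F] --> y -> p (x i) @[i --> F] --> p y.
Proof.
move=> fF sp pC xy.
have C0 : 0 < `|C| + 1 by rewrite ltr_wpDl.
have lip z z' : p z - p z' <= (`|C| + 1) * `|z - z'|.
  have := sp.1 (z - z') z'; have := pC (z - z'); rewrite subrK.
  by have := ler_norm C; have := normr_ge0 (z - z'); nra.
apply/cvgrPdist_lt => e e0; have /cvgrPdist_lt/(_ (e / (`|C| + 1))) := xy.
rewrite divr_gt0// => /(_ isT); apply: filterS => i; rewrite ltr_pdivlMr// mulrC.
have := lip y (x i); have := lip (x i) y; rewrite distrC ltr_norml => ? ? ?.
apply/andP; split; lra.
Qed.

End iterated_limits.

Section renorm_double_limit.
Context {R : realType} {X : completeNormedModType R}.
Variable c : nat -> X.
Hypotheses (sepX : separable_space X) (refX : reflexive_space X) (cd : dense_seq c).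

Lemma renorm_cvg_bounded (x : nat -> X) (l : R) : renorm c (x n) @[n --> \oo] --> l ->
  exists M, \forall n \near \oo, `|x n| <= M.
Proof.
move=> xl; have [_ [B [_ B0 _ NB]]] := equivalent_norm_bounds (renorm_equivalent c).
exists (B * (l + 1)).
have /cvgrPdist_lt/(_ _ ltr01) := xl; apply: filterS => n.
rewrite distrC ltr_distl => /andP[_ xn]; rewrite (le_trans (NB _))// ler_pM2l// ltW//.
Qed.

Lemma renorm_double_limit_convergence : double_limit_convergence (renorm c).
Proof.
move=> x l _ xl xx; have [M xM] := renorm_cvg_bounded xl.
have ucvg (U : set_system nat) : UltraFilter U -> \oo `<=` U ->
  exists y : X, x i @[i --> U] --> y.
  move=> uU Uoo; apply: (@near_additive_cvg _ _ _ U uU c x M sepX refX cd (Uoo _ xM)) => e e0.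
  have e4 : 0 < e / 4 by rewrite divr_gt0.
  have xle : \forall n \near \oo, `|l - renorm c (x n)| < e / 4.
    by have /cvgrPdist_lt/(_ _ e4) := xl.
  suff : \forall m \near \oo, \forall n \near \oo,
      renorm c (x m) + renorm c (x n) - renorm c (x m + x n) < e.
    by move=> /Uoo; apply: filterS => m /Uoo.
  apply: filterS2 (xle) (iterated_lim_near xx e4) => m xm; apply: filterS2 xle => n xn.
  move: xm xn; rewrite !ltr_norml => /andP[? ?] /andP[? ?] /andP[? ?]; lra.
have [U0 [uU0 U0oo]] := ultraFilterLemma (eventually_filter).
have [y0 xy0] := ucvg U0 uU0 U0oo.
apply: (cvgP y0); apply: cvg_of_ultra => U uU Uoo; have [y xy] := ucvg U uU Uoo.
suff -> : y0 = y by [].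
have Nlim (V : set_system nat) z : UltraFilter V -> \oo `<=` V -> x i @[i --> V] --> z ->
  renorm c z = l.
  move=> uV Voo xz.
  have h : renorm c (x i) @[i --> V] --> renorm c z.
    exact: seminorm_cvg _ (renorm_seminorm c) (renorm_le c) xz.
  by apply: (@cvg_unique _ _ _ _ _ _ h) => //; apply: cvg_trans xl; apply: cvg_app.
have Ny := Nlim U y uU Uoo xy; have Ny0 := Nlim U0 y0 uU0 U0oo xy0.
apply: (renorm_strictly_convex cd); first by rewrite Ny.
have [uc ul] := xx.
(* The iterated limit is computed along [U0] in [n] and along [U] in [m], so it equals the new norm
   of [y + y0]; strict convexity then identifies the two limits. *)
have inner m : renorm c (x m + y0) = limn (fun n => renorm c (x m + x n)).
  have h : renorm c (x m + x i) @[i --> U0] --> renorm c (x m + y0).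
    apply: (seminorm_cvg _ (renorm_seminorm c) (renorm_le c)).
    by apply: cvgD => //; exact: cvg_cst.
  apply: (@cvg_unique _ _ _ _ _ _ h) => //; apply: cvg_trans (uc m); exact: cvg_app.
have h : renorm c (x i + y0) @[i --> U] --> renorm c (y + y0).
  apply: (seminorm_cvg _ (renorm_seminorm c) (renorm_le c)).
  by apply: cvgD => //; exact: cvg_cst.
rewrite addrC Ny Ny0 -mulr2n -mulr_natl; apply: (@cvg_unique _ _ _ _ _ _ h) => //.
rewrite (funext inner); apply: cvg_trans ul; exact: cvg_app.
Qed.

End renorm_double_limit.

Lemma normr_weakly_lsc (R : realType) (X : normedModType R) (I : Type) (F : set_system I)
    (u : I -> X) (c : X) (e : R) : Filter F ->
  (forall f : dual X, f (u i) @[i --> F] --> (0 : R)) -> 0 < e ->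
  \forall i \near F, `|c| - e < `|c + u i|.
Proof.
move=> fF u0 e0; apply: (@seminorm_weakly_lsc R X I F (fun z => `|z|) 1) => // [|z].
  exact: seminorm_normr.
by rewrite mul1r.
Qed.

(** * Property (b): partial sums of weakly null terms *)

Section partial_sums.
Context {R : realType} {X : completeNormedModType R}.
Variable c : nat -> X.
Hypotheses (sepX : separable_space X) (refX : reflexive_space X) (cd : dense_seq c).
Context {I : Type} (U : set_system I) {uU : UltraFilter U}.

(* The last hypothesis keeps the partial sums [S k] of suitably chosen terms bounded; by weak lower
   semicontinuity, [N (S m + S n) >= 2 N (S m) - o(1)] for [m <= n], which makes [S] converge. *)
Lemma partial_sums_contra (x : I -> X) (M a : R) : 0 < a ->
  (\forall i \near U, `|x i| <= M) -> (forall f : dual X, f (x i) @[i --> U] --> (0 : R)) ->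
  `|x i| @[i --> U] --> a ->
  (forall b (e : R), 0 < e -> \forall m \near U,
    ultra_norm U x (b + x m) < ultra_norm U x b + e) ->
  False.
Proof.
move=> a0 xM x0 xa tx; set t := ultra_norm U x; set N := renorm c.
pose h k : R := 2^-1 ^+ k.
have h0 k : 0 < h k by rewrite exprn_gt0// invr_gt0.
have hS k : h k.+1 = h k / 2 by rewrite /h exprSr.
pose Q k (S y : X) i := N (y + S) - h k <= N (y + S + x i) /\
  `|S - y| - h k * (a / 8) <= `|S - y + x i|.
(* The list [s] holds all partial sums so far, the latest first: the next term must be compatible
   with each of them. *)
pose P (s : seq X) i := [/\ t (head 0 s + x i) <= t (head 0 s) + h (size s),
  a / 2 <= `|x i| & forall j : 'I_(size s), Q (size s) (head 0 s) (nth 0 s j) i].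
have /choice[g gP] : forall s, exists i, P s i.
  move=> s; apply: (@filter_ex _ U).
  have Qnear : \forall i \near U, forall j : 'I_(size s), Q (size s) (head 0 s) (nth 0 s j) i.
    apply: filter_forall => j.
    have e0 : 0 < h (size s) * (a / 8) by rewrite mulr_gt0// divr_gt0.
    have := @seminorm_weakly_lsc R X I U N 2 x
      (nth 0 s j + head 0 s) _ _ (renorm_seminorm c) (renorm_le c) x0 (h0 (size s)).
    move=> H; apply: filterS2 (H _) (normr_weakly_lsc (head 0 s - nth 0 s j) _ x0 e0).
    by move=> i /ltW ? /ltW ?; split.
  have a2 : 0 < a / 2 by rewrite divr_gt0.
  have /cvgrPdist_lt/(_ _ a2) xa2 := xa.
  apply: filterS3 (tx (head 0 s) _ (h0 (size s))) xa2 Qnear => i /ltW ti xi Qi; split => //.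
  by move: xi; rewrite ltr_norml => /andP[_]; lra.
pose st := fix st k := if k is k'.+1 then (head 0 (st k') + x (g (st k'))) :: st k' else [:: 0].
pose S k := head 0 (st k).
have size_st k : size (st k) = k.+1 by elim: k => //= k ->.
have nth_st k j : (j <= k)%N -> nth 0 (st k) (k - j) = S j.
  elim: k => [|k IH]; first by rewrite leqn0 => /eqP ->.
  rewrite leq_eqVlt => /predU1P[->|jk]; first by rewrite subnn.
  by rewrite subSn//= IH.
have SS k : S k.+1 = S k + x (g (st k)) by [].
have SQ k j : (j <= k)%N -> N (S j + S k) - h k.+1 <= N (S j + S k.+1) /\
    `|S k - S j| - h k.+1 * (a / 8) <= `|S k.+1 - S j|.
  move=> jk; have [_ _ Qk] := gP (st k).
  have kj : (k - j < size (st k))%N by rewrite size_st ltnS leq_subr.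
  have := Qk (Ordinal kj); rewrite /Q/= nth_st// size_st -/(S k) SS !addrA.
  by rewrite (addrAC (S k)).
have tS k : t (S k) <= t 0 + 2 * (1 - h k).
  elim: k => [|k IH]; first by rewrite /h expr0 subrr mulr0 addr0.
  have [+ _ _] := gP (st k); rewrite -/(S k) -SS size_st hS; move: IH (h0 k).
  lra.
(* The type dominates the norm at [S k] by weak lower semicontinuity, and [tS] bounds the type. *)
have SM k : `|S k| <= t 0 + 2.
  have : t (S k) <= t 0 + 2 by have := tS k; have := h0 k; lra.
  apply: le_trans; apply/ler_addgt0Pr => e e0.
  have lscS : \forall i \near U, `|S k| <= `|S k + x i| + e.
    by apply: filterS (normr_weakly_lsc (S k) _ x0 e0) => i; lra.
  apply: (filter_le_cvg _ (cvg_cst _) _ lscS).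
  by apply: cvgD; [exact: ultra_norm_cvg xM|exact: cvg_cst].
have NS j n : (j <= n)%N -> 2 * N (S j) - h j <= N (S j + S n).
  suff D m : 2 * N (S j) - (h j - h (j + m)%N) <= N (S j + S (j + m)%N).
    by move=> jn; have := D (n - j)%N; have := h0 n; rewrite subnKC//; lra.
  elim: m => [|m IH].
    have [_ NZ] := renorm_seminorm c.
    have N2 : N (S j + S j) = 2 * N (S j).
      have -> : S j + S j = 2 *: S j by rewrite scaler_nat.
      by rewrite /N NZ normr_nat.
    by rewrite addn0 N2 subrr subr0.
  have [+ _] := SQ (j + m)%N j (leq_addr _ _).
  by rewrite addnS; move: IH; rewrite hS; lra.
(* The distance starts at [a / 2] or more, and the later steps together lose at most [a / 8]. Two
   points within [a / 8] of a limit will contradict this. *)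
have dS j n : (j < n)%N -> a / 4 <= `|S n - S j|.
  suff D m : a / 2 - (h j.+1 - h (j.+1 + m)%N) * (a / 8) <= `|S (j.+1 + m)%N - S j|.
    move=> jn; have := D (n - j.+1)%N; rewrite subnKC//.
    have := h0 n; have : h j.+1 <= 1 by rewrite exprn_ile1// ?invr_ge0// invf_le1// ler1n.
    by have := a0; nra.
  elim: m => [|m IH].
    rewrite addn0 [h _ - _]subrr mul0r subr0 SS [S j + _]addrC addrK.
    by have [] := gP (st j).
  have [_] := SQ (j.+1 + m)%N j (leq_trans (leqnSn _) (leq_addr _ _)).
  by move: IH; rewrite addnS (hS (j.+1 + m)%N); lra.
have [V [uV Voo]] := ultraFilterLemma eventually_filter.
have [l lM Nl] : exists2 l, `|l| <= 2 * (t 0 + 2) & N (S n) @[n --> V] --> l.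
  apply: ultra_bounded_cvg; apply: filterE => n.
  rewrite ger0_norm ?seminorm_ge0//; last exact: renorm_seminorm.
  by rewrite (le_trans (renorm_le _ _))// ler_pM2l.
have [y Sy] : exists y : X, S n @[n --> V] --> y.
  apply: (near_additive_cvg sepX refX cd (M := t 0 + 2)); first exact: filterE.
  move=> e e0; have e4 : 0 < e / 4 by rewrite divr_gt0.
  have /cvgrPdist_lt/(_ _ e4) Nle := Nl.
  have hV : \forall n \near V, h n < e / 4.
    apply: Voo; have /cvgrPdist_lt/(_ _ e4) := @cvg_half_expr R 1.
    by apply: filterS => n; rewrite sub0r normrN mulr1 => /(le_lt_trans (ler_norm _)).
  apply: filterS2 (Nle) hV => m Nm hm.
  have mV : \forall n \near V, (m <= n)%N by apply: Voo; exact: nbhs_infty_ge.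
  apply: filterS2 Nle mV => n Nn mn; have := NS _ _ mn.
  move: Nm Nn; rewrite !ltr_norml => /andP[? ?] /andP[? ?]; rewrite -/N; lra.
have a8 : 0 < a / 8 by rewrite divr_gt0.
have /cvgrPdist_lt/(_ _ a8) yS := Sy.
have [m ym] := filter_ex yS.
have mV : \forall n \near V, (m < n)%N by apply: Voo; exact: nbhs_infty_gt.
have [n [yn mn]] := filter_ex (filterI yS mV).
have := dS _ _ mn; have := ler_distD y (S n) (S m).
by rewrite (distrC _ y); lra.
Qed.

End partial_sums.

(** * Weakly null families that barely increase the new norm *)

Section flat_sequences.
Context {R : realType} {X : completeNormedModType R}.
Variable c : nat -> X.
Hypothesis cd : dense_seq c.
Context {I : Type} (U : set_system I) {uU : UltraFilter U}.
Variables (x : I -> X) (M a : R).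
Hypotheses (a0 : 0 < a) (xM : \forall i \near U, `|x i| <= M)
  (x0 : forall f : dual X, f (x i) @[i --> U] --> (0 : R)) (xa : `|x i| @[i --> U] --> a)
  (xflat : forall e : R, 0 < e ->
     \forall m \near U, \forall n \near U, renorm c (x m + x n) - renorm c (x m) < e).

(** The rest of the series is a seminorm, so weak lower semicontinuity keeps it from dropping much;
    the increase of the term of index [j] is then bounded by that of the whole norm. *)
Lemma flat_directional_norm j (e : R) : 0 < e -> \forall m \near U, \forall n \near U,
  directional_norm (c j) (x m + x n) < directional_norm (c j) (x m) + e.
Proof.
move=> e0; have w0 := direction_weight_gt0 c j.
have we0 : 0 < direction_weight c j * (e / 2) by rewrite mulr_gt0// divr_gt0.
have rest_le z : renorm c z - renorm_term c j z <= 2 * `|z|.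
  by rewrite (le_trans _ (renorm_le c z))// gerBl (seminorm_ge0 _ (renorm_term_seminorm c j)).
apply: filterS (xflat we0) => m.
have := seminorm_weakly_lsc (x m) _ (renorm_rest c j) rest_le x0 we0.
move=> /(_ _); apply: filterS2 => n h1 h2; rewrite -(ltr_pM2l w0).
by move: h1 h2; rewrite /renorm_term; lra.
Qed.

(** The sum of the two halves barely rises and, by weak lower semicontinuity, the half with the
    minus sign barely drops; so the other half barely rises. Replacing |x m + x n| by |x m| uses
    semicontinuity again, with [sym_norm_mono]. For [q = e / (2 * k)] the losses are [2 * q] and 2 q
    |c j|. *)
Lemma flat_shift j (e : R) : 0 < e -> \forall m \near U, \forall n \near U,
  `| `|x m| *: c j + (x m + x n)| < `| `|x m| *: c j + x m| + e.
Proof.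
move=> e0; pose k := 1 + `|c j|; have k0 : 0 < k by rewrite ltr_pwDl.
have e'0 : 0 < e / (2 * k) by rewrite divr_gt0// mulr_gt0.
have eE : e = 2 * (e / (2 * k)) + 2 * (e / (2 * k)) * `|c j|.
  by rewrite -[X in _ = X + _]mulr1 -mulrDr -/k; field; rewrite gt_eqF.
apply: filterS (flat_directional_norm j e'0) => m.
have l1 := normr_weakly_lsc (x m) _ x0 e'0.
have x0N (f : dual X) : f (- x i) @[i --> U] --> (0 : R).
  rewrite -oppr0; have -> : (fun i => f (- x i)) = (fun i => - f (x i)) by apply/funext => i;
    rewrite dualN.
  by apply: cvgN; exact: x0.
have l2 := normr_weakly_lsc (`|x m| *: c j - x m) _ x0N e'0.
apply: filterS3 (l1 _) (l2 _) => n h1 h2.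
set z := x m + x n in h1 *; rewrite -addrA -opprD -/z in h2.
have h3 : sym_norm (c j) `|x m| z <= sym_norm (c j) (`|z| + e / (2 * k)) z.
  by apply: sym_norm_mono => //; move: h1; lra.
have h4 : sym_norm (c j) (`|z| + e / (2 * k)) z <= directional_norm (c j) z +
  2 * (e / (2 * k)) * `|c j|.
  have le1 y : `|(`|z| + e / (2 * k)) *: c j + y| <= `| `|z| *: c j + y| + e / (2 * k) * `|c j|.
    have -> : e / (2 * k) * `|c j| = `|(e / (2 * k)) *: c j| by rewrite normrZ gtr0_norm.
    rewrite (le_trans _ (ler_normD _ _))//.
    by rewrite scalerDl addrAC.
  by have := le1 z; have := le1 (- z); rewrite /directional_norm /sym_norm; lra.
have := le_trans h3 h4; rewrite [X in X <= _ -> _]/sym_norm => h5 h6.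
have h7 : directional_norm (c j) (x m) = `| `|x m| *: c j + x m| + `| `|x m| *: c j - x m| by [].
rewrite [X in _ < _ + X]eE; move: h2 h5 h6; rewrite h7; move: (e / (2 * k)) => q; lra.
Qed.

(** As |x m| tends to [a], a direction [c j] close to [a^-1 *: b] turns the shift of [flat_shift]
    into one close to [b]. *)
Lemma flat_ultra_norm b (e : R) : 0 < e ->
  \forall m \near U, ultra_norm U x (b + x m) < ultra_norm U x b + e.
Proof.
move=> e0; have M0 : 0 <= M by have [i] := filter_ex xM; exact: le_trans.
have e8 : 0 < e / 8 by rewrite divr_gt0.
have d0 : 0 < e / 16 / (M + 1) by rewrite !divr_gt0// ltr_wpDl.
have [j bj] := cd (a^-1 *: b) d0.
have near_b : \forall m \near U, `| `|x m| *: c j - b| < e / 8.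
  have : `|x i| / a * `|b| - `|b| @[i --> U] --> (0 : R).
    rewrite -(subrr `|b|) -[X in _ --> X - _]mul1r -(divff (lt0r_neq0 a0)).
    by apply: cvgB; [apply: cvgMr_tmp; apply: cvgMr_tmp|exact: cvg_cst].
  have e16 : 0 < e / 16 by rewrite divr_gt0.
  move=> /cvgrPdist_lt/(_ _ e16); apply: filterS2 xM => m xm; rewrite sub0r normrN => h.
  have := ler_distD (`|x m| *: (a^-1 *: b)) (`|x m| *: c j) b.
  rewrite -scalerBr normrZ normr_id (distrC (c j)).
  have -> : `| `|x m| *: (a^-1 *: b) - b| = `| `|x m| / a * `|b| - `|b| |.
    rewrite scalerA -[X in _ - X]scale1r -scalerBl normrZ.
    by rewrite -[X in _ = `|_ - X|]mul1r -mulrBl normrM normr_id.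
  move: bj; rewrite ltr_pdivlMr ?ltr_wpDl//.
  by have := normr_ge0 (a^-1 *: b - c j); nra.
apply: filterS3 near_b (flat_shift j e8) (ultra_norm_near b xM e8) => m bm xmn /andP[_ xb].
have [n [h1 /andP[h2 _]]] := filter_ex (filterI xmn (ultra_norm_near (b + x m) xM e8)).
have t1 y : `|b + y| <= `| `|x m| *: c j + y| + `| `|x m| *: c j - b|.
  by have := normr_scale_lip b (`|x m| *: c j) y ler01; rewrite !scale1r mul1r (distrC b).
have t2 y : `| `|x m| *: c j + y| <= `|b + y| + `| `|x m| *: c j - b|.
  by have := normr_scale_lip (`|x m| *: c j) b y ler01; rewrite !scale1r mul1r.
have := t1 (x m + x n); have := t2 (x m); rewrite addrA.
lra.
Qed.

End flat_sequences.

(** If [l2 <= l], the sequence is flat along every ultrafilter finer than [\oo]; a positive limit of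
    |x i| there contradicts [partial_sums_contra], so [x] would be norm null. *)
Lemma renorm_weakly_null_double_limit_gt (R : realType) (X : completeNormedModType R)
    (c : nat -> X) :
  separable_space X -> reflexive_space X -> dense_seq c ->
  weakly_null_double_limit_gt (renorm c).
Proof.
move=> sepX refX cd x l l2 x0 nx xl xx; rewrite ltNge; apply/negP => l2l.
have [M xM] := renorm_cvg_bounded xl.
apply: nx; apply: cvg_of_ultra => U uU Uoo.
have x0U (f : dual X) : f (x i) @[i --> U] --> (0 : R).
  by apply: cvg_trans (x0 f); exact: cvg_app.
have xMU : \forall i \near U, `|x i| <= M by exact: Uoo.
have [a _ xa] : exists2 a, `|a| <= M & `|x i| @[i --> U] --> a.
  by apply: ultra_bounded_cvg; apply: filterS xMU => i; rewrite normr_id.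
have a0 : 0 <= a by apply: (filter_le_cvg _ (cvg_cst 0) xa); apply: filterE => i.
move: a0; rewrite le_eqVlt => /predU1P[a0|a0]; first by apply/norm_cvg0P; rewrite a0.
exfalso; apply: (partial_sums_contra sepX refX cd a0 xMU x0U xa) => b e e0.
apply: (flat_ultra_norm cd a0 xMU x0U xa _ b e0) => d d0.
have d2 : 0 < d / 2 by rewrite divr_gt0.
have xle : \forall n \near \oo, `|l - renorm c (x n)| < d / 2.
  by have /cvgrPdist_lt/(_ _ d2) := xl.
suff : \forall m \near \oo, \forall n \near \oo, renorm c (x m + x n) - renorm c (x m) < d.
  by move=> /Uoo; apply: filterS => m /Uoo.
apply: filterS2 xle (iterated_lim_near xx d2) => m xm; apply: filterS => n.
by move: xm; rewrite !ltr_norml => /andP[? ?] /andP[? ?]; lra.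
Qed.

(** * Ekeland's variational principle on the dual *)

Section dual_ekeland.
Context {R : realType} {X : normedModType R}.
Implicit Types (f g h : dual X).

Lemma dual_cauchy_rate_cvg (f : nat -> dual X) (e : nat -> R) :
  (forall k n, (k <= n)%N -> `|f k - f n| <= e k) -> e n @[n --> \oo] --> (0 : R) ->
  exists g, forall k, `|f k - g| <= e k.
Proof.
move=> fe e0.
have fex x k n : (k <= n)%N -> `|f k x - f n x| <= e k * `|x|.
  move=> kn; rewrite (le_trans (dual_le_norm (f k - f n) x))//.
  by rewrite ler_wpM2r// fe.
have ex0 (x : X) : e n * `|x| @[n --> \oo] --> (0 : R) by rewrite -(mul0r `|x|); exact: cvgMr_tmp.
pose g x : R := limn (fun n => f n x : R).
have fg x : f n x @[n --> \oo] --> g x := cauchy_rate_cvg (T := R) (fex x) (ex0 x).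
have fgx x k : `|f k x - g x| <= e k * `|x| := cvg_rate (T := R) (fex x) (fg x) k.
have gl (a : R) x y : g (a *: x + y) = a * g x + g y.
  apply: cvg_lim => //; rewrite (_ : (fun n => f n _ : R) = fun n => a * f n x + f n y).
    by apply: cvgD; [apply: cvgMl_tmp|]; exact: fg.
  by apply/funext => n; rewrite dualD dualZ.
have gb x : `|g x| <= (`|f 0%N| + e 0%N) * `|x|.
  have := fgx x 0%N; have := dual_le_norm (f 0%N) x.
  by have := ler_distD (f 0%N x) 0 (g x); rewrite !sub0r !normrN; lra.
have [h hg] := dual_of_bounded gl gb; exists h => k; apply: dual_norm_le_bound.
  exact: le_trans (fe _ _ (leqnn k)).
by move=> x; have := fgx x k; rewrite -hg.
Qed.

Lemma dual_ekeland (psi : dual X -> R) (m eps : R) : 0 < eps -> (forall f, m <= psi f) ->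
  (forall (f : nat -> dual X) g a, `|f n - g| @[n --> \oo] --> (0 : R) ->
    (\forall n \near \oo, psi (f n) <= a) -> psi g <= a) ->
  exists f, forall g, psi f <= psi g + eps * `|g - f|.
Proof.
move=> eps0 psim lsc; pose S f : set (dual X) := [set g | psi g + eps * `|g - f| <= psi f].
have Strans f g h : S f g -> S g h -> S f h.
  move=> fg gh; apply: le_trans fg; apply: (le_trans _ (lerD gh (lexx _))).
  by rewrite -addrA lerD2l -mulrDr ler_wpM2l ?(ltW eps0)//; exact: ler_distD.
have Srefl f : S f f by rewrite /S/= subrr normr0 mulr0 addr0.
have /choice[nxt nxtP] : forall kf : nat * dual X, exists g,
    S kf.2 g /\ forall h, S kf.2 h -> psi g <= psi h + 2^-1 ^+ kf.1.
  move=> [k f] /=.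
  have infS : has_inf [set psi g | g in S f].
    by split; [exists (psi f), f|exists m => _ [g _ <-]].
  have h0 : 0 < 2^-1 ^+ k :> R by rewrite exprn_gt0// invr_gt0.
  have [_ [g Sg <-] lt_g] := inf_adherent h0 infS.
  exists g; split => // h Sh; apply: ltW; apply: lt_le_trans lt_g _; rewrite lerD2r.
  by apply: ge_inf; [have [] := infS|exists h].
pose f := fix f k : dual X := if k is k'.+1 then nxt (k', f k') else 0.
have Sf k n : (k <= n)%N -> S (f k) (f n).
  elim: n => [|n IH]; first by rewrite leqn0 => /eqP ->.
  rewrite leq_eqVlt => /predU1P[->//|kn]; apply: Strans (IH kn) _.
  by have [] := nxtP (n, f n).
have fmin k h : S (f k) h -> psi (f k.+1) <= psi h + 2^-1 ^+ k by have [_] := nxtP (k, f k);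
  exact.
clearbody f.
(* Membership in [S] bounds the distance by a drop of [psi], and [f k.+1] nearly minimizes [psi] on
   [S (f k)]. *)
have rate k n : (k <= n)%N -> `|f k.+1 - f n.+1| <= 2^-1 ^+ k * eps^-1.
  move=> kn; rewrite ler_pdivlMr// mulrC distrC.
  have := fmin k _ (Sf k n.+1 (leqW kn)); have := Sf k.+1 n.+1 kn; rewrite /S/=; lra.
have [g fg] := dual_cauchy_rate_cvg rate (cvg_half_expr _).
have fg0 : `|f n.+1 - g| @[n --> \oo] --> (0 : R).
  apply: (squeeze_cvgr _ (cvg_cst 0) (cvg_half_expr eps^-1)).
  by apply: nearW => n; rewrite normr_ge0 fg.
have Sg k : S (f k) g.
  rewrite /S/= -lerBrDr; apply/ler_addgt0Pr => d d0; apply: lsc (fg0) _.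
  have d' : 0 < d / eps by rewrite divr_gt0.
  have kn : \forall n \near \oo, (k <= n)%N by exact: nbhs_infty_ge.
  have /cvgrPdist_lt/(_ _ d') := fg0; apply: filterS2 kn => n kn.
  rewrite sub0r normrN normr_id ltr_pdivlMr// mulrC => gd.
  have tri : eps * `|g - f k| <= eps * `|f n.+1 - g| + eps * `|f n.+1 - f k|.
    rewrite -mulrDr ler_pM2l//.
    apply: le_trans (ler_distD (f n.+1) g (f k)) _; rewrite lerD2r.
    by rewrite -opprB normrN.
  have aux : forall A B C D E : R, A + B <= C -> D <= E + B -> E < d ->
      A <= C - D + d.
    by clear; move=> *; lra.
  exact: aux (Sf k n.+1 (leqW kn)) tri gd.
(* A violating [h] would lie in every [S (f k)], so near-minimality would give [psi g <= psi h]. *)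
exists g => h; rewrite leNgt; apply/negP => gh.
have Sh k : S (f k) h by apply: Strans (Sg k) _; exact: ltW.
have : psi g <= psi h.
  have hl : psi h + 2^-1 ^+ n * 1 @[n --> \oo] --> psi h.
    by rewrite -[X in _ --> X]addr0; apply: cvgD; [exact: cvg_cst|exact: cvg_half_expr].
  apply: (filter_le_cvg _ (cvg_cst _) hl); apply: nearW => n; rewrite mulr1.
  have := fmin n _ (Sh n); have := Sg n.+1; rewrite /S/=.
  by have := mulr_ge0 (ltW eps0) (normr_ge0 (g - f n.+1)); lra.
by move: gh; have := mulr_ge0 (ltW eps0) (normr_ge0 (h - g)); lra.
Qed.

End dual_ekeland.

Lemma cvg_dist_rate (R : realType) (u r : nat -> R) (l K : R) : r n @[n --> \oo] --> (0 : R) ->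
  (forall n, `|u n - l| <= r n * K) -> u n @[n --> \oo] --> l.
Proof.
move=> r0 ur; have rK : r n * K @[n --> \oo] --> (0 : R).
  by rewrite -(mul0r K); exact: cvgMr_tmp.
apply/cvgrPdist_lt => e e0; have /cvgrPdist_lt/(_ _ e0) := rK; apply: filterS => n.
by rewrite sub0r normrN distrC; apply: le_lt_trans; rewrite (le_trans (ur n))// ler_norm.
Qed.

(** * The conjugate of half the squared norm *)

Section half_square_conjugate.
Context {R : realType} {X : normedModType R}.
Variables (N : X -> R) (A B : R).
Hypotheses (nN : is_norm N) (A0 : 0 < A) (B0 : 0 < B)
  (NA : forall x, N x <= A * `|x|) (NB : forall x, `|x| <= B * N x).
Implicit Types (f g h : dual X).

Let sN : seminorm N := is_norm_seminorm nN.

Definition conj_set f : set R := [set f x - N x ^+ 2 / 2 | x in [set: X]].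

(** The Fenchel conjugate of [N ^+ 2 / 2], i.e. half the square of the dual norm of [N]. *)
Definition conjugate f : R := sup (conj_set f).

Lemma conj_set_has_sup f : has_sup (conj_set f).
Proof.
split; first by exists (f 0 - N 0 ^+ 2 / 2), 0.
exists ((`|f| * B) ^+ 2 / 2) => _ [x _ <-].
have fN : f x <= `|f| * B * N x.
  by rewrite (le_trans (ler_norm _))// (le_trans (dual_le_norm f x))// -mulrA ler_wpM2l.
by have := sqr_ge0 (`|f| * B - N x); rewrite sqrrB; move: fN; nra.
Qed.

Lemma conj_ge f x : f x - N x ^+ 2 / 2 <= conjugate f.
Proof. by apply: ub_le_sup; [have [] := conj_set_has_sup f|exists x]. Qed.

Lemma conj_le f (a : R) : (forall x, f x - N x ^+ 2 / 2 <= a) -> conjugate f <= a.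
Proof.
by move=> h; apply: ge_sup => [|_ [x _ <-]//]; have [] := conj_set_has_sup f.
Qed.

Lemma conj_adherent f (e : R) : 0 < e -> exists x, conjugate f - e < f x - N x ^+ 2 / 2.
Proof. by move=> e0; have [_ [x _ <-]] := sup_adherent e0 (conj_set_has_sup f); exists x. Qed.

Lemma conj_ge0 f : 0 <= conjugate f.
Proof.
have := conj_ge f 0; rewrite dual0; have -> : N 0 = 0 by rewrite -(scale0r 0) sN.2 normr0 mul0r.
by rewrite expr0n/= mul0r subr0.
Qed.

(** Test the supremum at |F| times a point of the unit ball that norms [f] up to 1: the linear part
    compensates [F f] up to |F|, and the quadratic part is bounded. *)
Lemma conj_sub_bidual_lb (F : dual (dual X)) : exists m, forall f, m <= conjugate f - F f.
Proof.
exists (- (`|F| + (A * `|F|) ^+ 2 / 2)) => f.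
have [x x1 fx] : exists2 x : X, `|x| <= 1 & `|f| - 1 <= f x.
  have [_ [x x1 <-] fx] := sup_adherent ltr01 (dual_ball_image_has_sup f).
  have [f0|f0] := leP 0 (f x).
    by exists x => //; rewrite ltW// (lt_le_trans fx)// ger0_norm.
  by exists (- x); rewrite ?normrN// dualN ltW// (lt_le_trans fx)// ltr0_norm.
have := conj_ge f (`|F| *: x); rewrite dualZ sN.2 normr_id.
have := le_trans (ler_norm _) (dual_le_norm F f).
have F0 := normr_ge0 F.
have NxA : N x <= A by rewrite (le_trans (NA x))// ler_piMr// ltW.
have N0 : 0 <= N x := seminorm_ge0 x sN.
have : (`|F| * N x) ^+ 2 <= (A * `|F|) ^+ 2.
  by rewrite ler_sqr ?nnegrE ?mulr_ge0 ?(ltW A0)// mulrC ler_wpM2r.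
have : `|F| * (`|f| - 1) <= `|F| * f x by rewrite ler_wpM2l.
move: ((`|F| * N x) ^+ 2) ((A * `|F|) ^+ 2) (`|F| * f x) (F f) (conjugate f) => a b p q r.
by rewrite mulrBr mulr1; lra.
Qed.

(** The conjugate is a supremum of continuous functions of [f], and [F] is continuous. *)
Lemma conj_sub_bidual_lsc (F : dual (dual X)) (f : nat -> dual X) g (a : R) :
  `|f n - g| @[n --> \oo] --> (0 : R) ->
  (\forall n \near \oo, conjugate (f n) - F (f n) <= a) -> conjugate g - F g <= a.
Proof.
move=> fg fa; rewrite lerBlDr; apply: conj_le => x.
have fgx : f n x @[n --> \oo] --> (g x : R).
  by apply: (cvg_dist_rate fg) => n; exact: dual_le_norm (f n - g) x.
have Fgx : F (f n) @[n --> \oo] --> (F g : R).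
  apply: (cvg_dist_rate (K := `|F|) fg) => n; rewrite -dualB mulrC.
  exact: dual_le_norm.
have l1 : f n x - N x ^+ 2 / 2 @[n --> \oo] --> g x - N x ^+ 2 / 2.
  by apply: cvgB; [exact: fgx|exact: cvg_cst].
have l2 : a + F (f n) @[n --> \oo] --> a + F g.
  by apply: cvgD; [exact: cvg_cst|exact: Fgx].
apply: (filter_le_cvg _ l1 l2); apply: filterS fa => n; rewrite lerBlDr; apply: le_trans.
exact: conj_ge.
Qed.

(* Test [conjugate f] at the midpoint of [x] and [y]. *)
Lemma conj_midpoint f x y :
  2 * (N x ^+ 2 + N y ^+ 2) - N (x + y) ^+ 2 <=
  4 * ((conjugate f - (f x - N x ^+ 2 / 2)) + (conjugate f - (f y - N y ^+ 2 / 2))).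
Proof.
have := conj_ge f (2^-1 *: (x + y)); rewrite dualZ dualD sN.2 ger0_norm ?invr_ge0//.
by rewrite exprMn; lra.
Qed.

End half_square_conjugate.

Definition conj_gap (R : realType) (X : normedModType R) (N : X -> R) (f : dual X) x : R :=
  conjugate N f - (f x - N x ^+ 2 / 2).

(** * Maximizing sequences under property (a) *)

Section maximizing_sequences.
Context {R : realType} {X : normedModType R}.
Variables (N : X -> R) (A B : R).
Hypotheses (nN : is_norm N) (A0 : 0 < A) (B0 : 0 < B)
  (NA : forall x, N x <= A * `|x|) (NB : forall x, `|x| <= B * N x)
  (dlcN : double_limit_convergence N).
Implicit Types (f g h : dual X).

Let sN : seminorm N := is_norm_seminorm nN.

(** Along an ultrafilter all limits exist, and [conj_midpoint] forces the iterated limit to be twice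
    the limit of the norms. A subsequence realizes these limits along [\oo], and (a) applies to
    it. *)
Lemma conj_maximizing_subseq f (x : nat -> X) (K : R) : (forall k, N (x k) <= K) ->
  conj_gap N f (x k) @[k --> \oo] --> (0 : R) ->
  exists (s : nat -> nat) (y : X), (forall k, (k <= s k)%N) /\ x (s k) @[k --> \oo] --> y.
Proof.
move=> xK xf; have [V [uV Voo]] := ultraFilterLemma eventually_filter.
have N0 z : 0 <= N z := seminorm_ge0 z sN.
have d0 k : 0 <= conj_gap N f (x k) by rewrite subr_ge0; exact: conj_ge.
pose l := ulim V (fun n => N (x n)).
have ll : N (x n) @[n --> V] --> l.
  by apply: (@ulim_cvg _ _ _ _ _ K); apply: filterE => n; rewrite ger0_norm.
pose L m := ulim V (fun n => N (x m + x n)).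
have LL m : N (x m + x n) @[n --> V] --> L m.
  apply: (@ulim_cvg _ _ _ _ _ (K + K)); apply: filterE => n; rewrite ger0_norm//.
  by rewrite (le_trans (sN.1 _ _))// lerD.
have dV : conj_gap N f (x n) @[n --> V] --> (0 : R) by apply: cvg_trans xf; exact: cvg_app.
have l0 : 0 <= l by apply: (filter_le_cvg _ (cvg_cst 0) ll); exact: filterE.
have L0 m : 0 <= L m by apply: (filter_le_cvg _ (cvg_cst 0) (LL m)); exact: filterE.
have Lle m : L m <= N (x m) + l.
  apply: (filter_le_cvg _ (LL m)); last by apply: filterE => n; exact: sN.1.
  by apply: cvgD; [exact: cvg_cst|].
have Lge m : 2 * (N (x m) ^+ 2 + l ^+ 2) - L m ^+ 2 <= 4 * (conj_gap N f (x m) + 0).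
  have c1 : 2 * (N (x m) ^+ 2 + N (x n) ^+ 2) - N (x m + x n) ^+ 2 @[n --> V] -->
      2 * (N (x m) ^+ 2 + l ^+ 2) - L m ^+ 2.
    apply: cvgB; last by apply: cvgM; exact: LL.
    by apply: cvgMl_tmp; apply: cvgD; [exact: cvg_cst|apply: cvgM].
  have c2 : 4 * (conj_gap N f (x m) + conj_gap N f (x n)) @[n --> V] -->
    4 * (conj_gap N f (x m) + 0).
    by apply: cvgMl_tmp; apply: cvgD; [exact: cvg_cst|].
  apply: (filter_le_cvg _ c1 c2); apply: filterE => n; exact: conj_midpoint.
(* Controlling all [m <= k], not only earlier values of [s], makes the choice non-recursive: [s m]
   is covered as soon as [s m <= k]. *)
have /choice[s sP] : forall k, exists n, [/\ (k <= n)%N, `|N (x n) - l| <= 2^-1 ^+ k * 1 &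
    forall m : 'I_k.+1, `|N (x m + x n) - L m| <= 2^-1 ^+ k * 1].
  move=> k; apply: (@filter_ex _ V).
  have h0 : 0 < 2^-1 ^+ k * 1 :> R by rewrite mulr1 exprn_gt0// invr_gt0.
  have kn : \forall n \near V, (k <= n)%N by apply: Voo; exact: nbhs_infty_ge.
  have nl : \forall n \near V, `|N (x n) - l| <= 2^-1 ^+ k * 1.
    by have /cvgrPdist_lt/(_ _ h0) := ll; apply: filterS => n; rewrite distrC => /ltW.
  have nL : \forall n \near V, forall m : 'I_k.+1, `|N (x m + x n) - L m| <= 2^-1 ^+ k * 1.
    apply: filter_forall => m.
    by have /cvgrPdist_lt/(_ _ h0) := LL m; apply: filterS => n; rewrite distrC => /ltW.
  by apply: filterS3 kn nl nL => n.
have sk k : (k <= s k)%N by have [] := sP k.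
have soo : s n @[n --> \oo] --> \oo.
  move=> P [n0 _ nP]; exists n0 => // n /= n0n; apply: nP => /=; exact: leq_trans n0n (sk n).
have sl : N (x (s n)) @[n --> \oo] --> l.
  apply: (cvg_dist_rate (cvg_half_expr 1) (K := 1)) => n; rewrite mulr1.
  by have [] := sP n.
have sLm m : N (x (s m) + x (s n)) @[n --> \oo] --> L (s m).
  apply/cvgrPdist_lt => e e0; have /cvgrPdist_lt/(_ _ e0) := @cvg_half_expr R 1.
  have mn : \forall n \near \oo, (s m <= n)%N by exact: nbhs_infty_ge.
  apply: filterS2 mn => n mn; rewrite sub0r normrN => he; rewrite distrC.
  have [_ _ /(_ (Ordinal (mn : (s m < n.+1)%N)))/= hL] := sP n.
  by rewrite (le_lt_trans hL)// (le_lt_trans _ he)// ler_norm.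
have sd : conj_gap N f (x (s n)) @[n --> \oo] --> (0 : R).
  exact: (cvg_comp _ _ soo xf).
have sL : L (s n) @[n --> \oo] --> 2 * l.
  have nn n : 0 <= N (x (s n)) by [].
  have up : N (x (s n)) + l @[n --> \oo] --> 2 * l.
    by rewrite mulr_natl mulr2n; apply: cvgD => //; exact: cvg_cst.
  have low : Num.sqrt (2 * (N (x (s n)) ^+ 2 + l ^+ 2) - 4 * (conj_gap N f (x (s n)) + 0))
      @[n --> \oo] --> 2 * l.
    have -> : 2 * l = Num.sqrt (2 * (l ^+ 2 + l ^+ 2) - 4 * (0 + 0)).
      by rewrite addr0 mulr0 subr0 -mulr2n -[l ^+ 2 *+ 2]mulr_natl mulrA -natrM (natrX _ 2 2)
        -exprMn sqrtr_sqr ger0_norm// mulr_ge0.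
    apply: continuous_cvg; first exact: sqrt_continuous.
    apply: cvgB; last by apply: cvgMl_tmp; apply: cvgD => //; exact: cvg_cst.
    by apply: cvgMl_tmp; apply: cvgD; [apply: cvgM|exact: cvg_cst].
  apply: (squeeze_cvgr _ low up); apply: nearW => n; rewrite Lle andbT.
  rewrite -[leRHS](ger0_norm (L0 _)) -sqrtr_sqr ler_sqrt ?sqr_ge0//.
  by have := Lge (s n); lra.
have : cvgn (x \o s).
  apply: (dlcN (l := l)) => //.
    exists (B * K); split => [|M BM _ [n _ <-]]; first exact: num_real.
    by rewrite /= (le_trans (NB _))// ltW// (le_lt_trans _ BM)// ler_pM2l.
  split=> [m|]; first by apply: cvgP; exact: sLm.
  rewrite (_ : (fun m => limn _) = fun m => L (s m))//.
  by apply/funext => m; apply: cvg_lim => //; exact: sLm.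
by move=> /cvg_ex[y xy]; exists s, y.
Qed.

(** The midpoint inequality yields [N y = N z] and [N (y + z) = 2 * N y]. The sequence alternating
    between [y] and [z] then satisfies the hypothesis of (a), so it converges. *)
Lemma conj_maximizer_unique f y z : conj_gap N f y = 0 -> conj_gap N f z = 0 -> y = z.
Proof.
move=> fy fz; have := conj_midpoint nN NB f y z.
rewrite -/(conj_gap N f y) -/(conj_gap N f z) fy fz addr0 mulr0 => mid.
have N0 w : 0 <= N w := seminorm_ge0 w sN.
have tri := sN.1 y z.
have yz : N y = N z by have := N0 y; have := N0 z; have := N0 (y + z); nra.
have Nyz : N (y + z) = 2 * N y.
  by apply/eqP; rewrite eq_le -yz in tri mid *; have := N0 y; have := N0 (y + z); nra.
pose x n := if odd n then y else z.
have N2 w : N (w + w) = 2 * N w by rewrite -mulr2n -scaler_nat sN.2 normr_nat.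
have xx m n : N (x m + x n) = 2 * N y.
  by rewrite /x; case: ifP; case: ifP; rewrite ?N2// ?yz// -?yz// addrC.
have xN n : N (x n) = N y by rewrite /x; case: ifP.
have /cvg_ex[w /= xw] : cvgn x.
  apply: (dlcN (l := N y)).
  - exists (B * N y); split => [|M BM _ [n _ <-]]; first exact: num_real.
    by rewrite /= (le_trans (NB _))// xN ltW.
  - by under eq_fun do rewrite xN; exact: cvg_cst.
  - split=> [m|]; first by under eq_fun do rewrite xx; exact: is_cvg_cst.
    under eq_fun do (under eq_fun do rewrite xx; rewrite lim_cst//).
    exact: cvg_cst.
apply/eqP; rewrite -subr_eq0 -normr_le0; apply/ler_addgt0Pl => e e0; rewrite addr0.
have e2 : 0 < e / 2 by rewrite divr_gt0.
have /cvgrPdist_lt/(_ _ e2)[k _ kP] := xw.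
have k2 : (k <= k.*2)%N by rewrite -addnn leq_addr.
have := kP k.*2 k2; have := kP k.*2.+1 (leqW k2).
rewrite /x /= odd_double/= => h1 h2; rewrite distrC in h1.
by have := ler_distD w y z; lra.
Qed.

End maximizing_sequences.

(** * Property (a) implies reflexivity *)

Section double_limit_reflexive.
Context {R : realType} {X : completeNormedModType R}.
Variables (N : X -> R) (A B : R).
Hypotheses (nN : is_norm N) (A0 : 0 < A) (B0 : 0 < B)
  (NA : forall x, N x <= A * `|x|) (NB : forall x, `|x| <= B * N x)
  (dlcN : double_limit_convergence N).
Implicit Types (f g h : dual X).

Let sN : seminorm N := is_norm_seminorm nN.

Lemma ekeland_point_maximizer (F : dual (dual X)) f (eps : R) h : 0 <= eps ->
  (forall g, conjugate N f - F f <= conjugate N g - F g + eps * `|g - f|) ->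
  exists2 y, conj_gap N f y = 0 & F h - eps * `|h| <= h y.
Proof.
move=> eps0 fE; pose t k : R := 2^-1 ^+ k.
have t0 k : 0 < t k by rewrite exprn_gt0// invr_gt0.
have t1 k : t k <= 1 by rewrite exprn_ile1// ?invr_ge0// invf_le1// ler1n.
have tl : t n @[n --> \oo] --> (0 : R).
  by have := @cvg_half_expr R 1; under eq_fun do rewrite mulr1.
(* The error [t k ^+ 2] stays negligible after division by [t k], so comparison with the Ekeland
   inequality at [f + t k *: h] bounds [h (x k)] from below. *)
have /choice[x xP] : forall k, exists x, conjugate N (f + t k *: h) - t k ^+ 2 <
    (f x + t k * h x) - N x ^+ 2 / 2.
  by move=> k; apply: conj_adherent; rewrite // exprn_gt0.
have N0 z : 0 <= N z := seminorm_ge0 z sN.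
(* The conjugate is nonnegative and the error at most 1, so [C * n - n ^+ 2 / 2 > -1] for
   [n = N (x k)], which fails beyond [2 * C + 2]. *)
pose C := (`|f| + `|h|) * B; pose K := 2 * C + 2.
have C0 : 0 <= C by rewrite mulr_ge0 ?addr_ge0 ?(ltW B0).
have xK k : N (x k) <= K.
  have := conj_ge0 nN NB (f + t k *: h); have := xP k.
  have fx : f (x k) + t k * h (x k) <= C * N (x k).
    have hx : `|h (x k)| <= `|h| * (B * N (x k)).
      by rewrite (le_trans (dual_le_norm _ _))// ler_wpM2l.
    have fx : `|f (x k)| <= `|f| * (B * N (x k)).
      by rewrite (le_trans (dual_le_norm _ _))// ler_wpM2l.
    have tx : t k * h (x k) <= `|h (x k)|.
      by rewrite (le_trans (ler_norm _))// normrM gtr0_norm// ler_piMl.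
    by move: tx hx fx (ler_norm (f (x k))); rewrite /C; nra.
  have tt : t k ^+ 2 <= 1 by rewrite exprn_ile1// ltW.
  move: fx tt; rewrite /K; move: (conjugate N _) (N0 (x k)) => q n0 fx tt lt q0.
  by rewrite leNgt; apply/negP => big; move: (N (x k)) big n0 fx lt => n; nra.
have hB k : `|h (x k)| <= `|h| * (B * K).
  by rewrite (le_trans (dual_le_norm _ _))// ler_wpM2l// (le_trans (NB _))// ler_pM2l.
have key k : conjugate N f + t k * F h - eps * (t k * `|h|) <= conjugate N (f + t k *: h).
  have := fE (f + t k *: h); have -> : f + t k *: h - f = t k *: h by rewrite addrC addKr.
  rewrite normrZ gtr0_norm//.
  by rewrite dualD dualZ; lra.
have xi k : F h - eps * `|h| - t k <= h (x k).
  rewrite -(ler_pM2l (t0 k)); have := conj_ge NB f (x k).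
  by move: (xP k) (key k); rewrite expr2; lra.
have xf : conj_gap N f (x k) @[k --> \oo] --> (0 : R).
  apply: (cvg_dist_rate (K := 1 + `|h| * (B * K) + `|F h| + eps * `|h|) tl) => k.
  rewrite subr0 /conj_gap ger0_norm; last by rewrite subr_ge0; exact: conj_ge NB _ _.
  have tt : t k ^+ 2 <= t k by rewrite expr2 ler_piMr// ltW.
  have th : t k * h (x k) <= t k * (`|h| * (B * K)).
    by rewrite ler_pM2l// (le_trans (ler_norm _)).
  have tF : - (t k * F h) <= t k * `|F h|.
    by rewrite -mulrN ler_pM2l// -normrN ler_norm.
  by move: (xP k) (key k) tt th tF; lra.
have [s [y [sk xy]]] := conj_maximizing_subseq nN B0 NB dlcN xK xf.
have soo : s n @[n --> \oo] --> \oo.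
  move=> P [n0 _ nP]; exists n0 => // n /= n0n; apply: nP => /=; exact: leq_trans n0n (sk n).
have dual_lim g : g (x (s n)) @[n --> \oo] --> (g y : R).
  by apply: (cvg_comp _ _ xy); exact: dual_continuous.
have Nlim : N (x (s n)) @[n --> \oo] --> N y by exact: seminorm_cvg _ sN NA xy.
exists y.
  have c1 : conj_gap N f (x (s k)) @[k --> \oo] --> conj_gap N f y.
    apply: cvgB; first exact: cvg_cst.
    apply: cvgB; first exact: dual_lim.
    by apply: cvgMr_tmp; apply: cvgM.
  have c2 : conj_gap N f (x (s k)) @[k --> \oo] --> (0 : R).
    exact: (cvg_comp _ _ soo xf).
  by apply: (@cvg_unique _ _ _ _ _ _ c1 c2).
have c1 : F h - eps * `|h| - t (s n) @[n --> \oo] --> F h - eps * `|h|.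
  rewrite -[X in _ --> X]subr0; apply: cvgB; first exact: cvg_cst.
  exact: (cvg_comp _ _ soo tl).
by apply: (filter_le_cvg _ c1 (dual_lim h)); apply: nearW => n; exact: xi.
Qed.

(** The maximizers obtained for [h] and [- h] coincide with [y] by uniqueness, so the one-sided
    bounds combine into a two-sided one. *)
Lemma bidual_approx (F : dual (dual X)) (eps : R) : 0 < eps ->
  exists y : X, forall h, `|F h - h y| <= eps * `|h|.
Proof.
move=> eps0; have [m mP] := conj_sub_bidual_lb nN A0 NA NB F.
have [f fE] := dual_ekeland eps0 mP (@conj_sub_bidual_lsc _ _ N B NB F).
have max h := ekeland_point_maximizer h (ltW eps0) fE.
have [y fy _] := max 0; exists y => h.
have [y1 fy1 hy1] := max h; have [y2 fy2 hy2] := max (- h).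
move: hy1 hy2; rewrite -(conj_maximizer_unique nN NB dlcN fy fy1).
rewrite -(conj_maximizer_unique nN NB dlcN fy fy2) normrN dualN dual_oppE => hy1 hy2.
by rewrite ler_norml; apply/andP; split; lra.
Qed.

Lemma double_limit_reflexive : reflexive_space X.
Proof.
move=> F; pose e k : R := 2^-1 ^+ k.
have e0 k : 0 < e k by rewrite exprn_gt0// invr_gt0.
have /choice[y yP] k := bidual_approx F (e0 k).
have yk k n : (k <= n)%N -> `|y k - y n| <= e k * 2.
  move=> kn; have [h h1 hy] := norming_functional (y k - y n).
  have nh : `|h| <= 1 by apply: dual_norm_le_bound => // z; rewrite mul1r.
  have en : e n <= e k by rewrite ler_wiXn2l// ?invr_ge0// invf_le1// ler1n.
  rewrite -hy dualB; have := yP k h; have := yP n h.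
  rewrite !ler_norml => /andP[_ a1] /andP[a2 _].
  have b1 : e n * `|h| <= e k by rewrite -[leRHS]mulr1 ler_pM// ltW.
  have b2 : e k * `|h| <= e k by rewrite ler_piMr// ltW.
  by move: a1 a2 b1 b2; lra.
have /cvg_ex[z /= yz] := cauchy_rate_cvg yk (cvg_half_expr 2).
exists z => h; have hl : h (y n) @[n --> \oo] --> (h z : R).
  by apply: (cvg_comp _ _ yz); exact: dual_continuous.
apply: (@cvg_unique _ _ _ _ _ _ _ hl) => //.
apply: (cvg_dist_rate (cvg_half_expr 1) (K := `|h|)) => n.
by rewrite mulr1 distrC.
Qed.

End double_limit_reflexive.

Theorem corollary3p1 (R : realType) (X : completeNormedModType R)
    (sepX : separable_space X) :
  (reflexive_space X <->
     exists N : X -> R, equivalent_norm N /\ double_limit_convergence N) /\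
  (reflexive_space X ->
     exists N : X -> R,
       [/\ equivalent_norm N, double_limit_convergence N
         & weakly_null_double_limit_gt N]).
Proof.
have [c cd] := separable_dense_seq sepX.
have main : reflexive_space X -> exists N : X -> R,
    [/\ equivalent_norm N, double_limit_convergence N & weakly_null_double_limit_gt N].
  move=> refX; exists (renorm c); split; first exact: renorm_equivalent.
    exact: renorm_double_limit_convergence.
  exact: renorm_weakly_null_double_limit_gt.
split => //; split => [/main[N [eN dN _]]|[N [eN dN]]]; first by exists N.
have [A [B [A0 B0 NA NB]]] := equivalent_norm_bounds eN.
exact: double_limit_reflexive eN.1 A0 B0 NA NB dN.
Qed.
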